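(* Let $\mathcal{E}$ be a locally cartesian closed category with a terminal object $\mathbf{1}$ and disjoint finite sums. Let $\mathcal{E}[\mathcal{W}^{-1}]$ denote the localization of $\mathcal{E}$ at the class $\mathcal{W}$ of dense monomorphisms. Then the pseudofunctor $\mathbf{Poly}\,\mathcal{E}\to\mathbf{Poly}\,\mathcal{E}[\mathcal{W}^{-1}]$ induced by the localization functor preserves $(I,J)=(1,1)$ derivatives, and all such derivatives exist in $\mathbf{Poly}\,\mathcal{E}[\mathcal{W}^{-1}]$.
   Context: $\mathcal{E}$ is locally cartesian closed if it has pullbacks and each pullback functor $\Delta_p\colon\mathcal{E}/B\to\mathcal{E}/E$ has a right adjoint $\Pi_p$. For $q\colon X\to Y$, the negation is $\neg q:=\Pi_q(\mathbf{0}\to X)\in\mathcal{E}/Y$, with $\mathbf{0}$ initial. A morphism $f\colon A\to B$ is dense if $\neg\neg f\cong\mathrm{id}_B$ in $\mathcal{E}/B$. $\mathcal{W}$ is the class of monomorphisms that are dense, and $\mathcal{E}[\mathcal{W}^{-1}]$ is obtained from $\mathcal{E}$ by formally inverting $\mathcal{W}$; it is locally cartesian closed, and the localization functor $\mathcal{E}\to\mathcal{E}[\mathcal{W}^{-1}]$ preserves pullbacks and distributivity pullbacks (the terminal pullback diagrams encoding $\Pi$), so it acts on polynomials. For a locally cartesian closed category $\mathcal{C}$ (with terminal object $\mathbf{1}$ and finite sums), $\mathbf{Poly}\,\mathcal{C}$ is the bicategory whose objects are those of $\mathcal{C}$, whose 1-cells $I\to J$ are polynomials $I\xleftarrow{s}E\xrightarrow{p}B\xrightarrow{t}J$,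 and whose 2-cells are cartesian maps (pairs $E_1\to E_2$, $B_1\to B_2$ over $I$ and $J$ making the middle square a pullback). $\mathbf{Poly}\,\mathcal{C}(1,1)$ is the hom-category on $I=J=\mathbf{1}$: objects are morphisms $p\colon E\to B$, morphisms are pullback squares. For $p\colon E\to B$, put $p\ast\mathbf{1}:=[p,\mathrm{id}_B]\colon E+B\to B$. The $(1,1)$ derivative functor $D$ is the right adjoint to $(-)\ast\mathbf{1}\colon\mathbf{Poly}\,\mathcal{C}(1,1)\to\mathbf{Poly}\,\mathcal{C}(1,1)$; a derivative of $p$ is an object $Dp$ with a universal arrow $Dp\ast\mathbf{1}\to p$. A pseudofunctor preserves derivatives if it sends each existing derivative $Dp$ (with its universal arrow) to a derivative of the image of $p$.
   Formalization: Preservation of derivatives is stated for those E whose localization functor preserves distributivity pullbacks; this can fail (e.g. functors from the poset ω to sets), and then the pseudofunctor is undefined and preservation can be false. Existence of derivatives is unconditional. *)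

(* Defs.v *)
(* Vanilla Stdlib.  Morphisms of a category are compared with Leibniz equality,
   so quotients and subtypes of hom-types rely on the classical axioms below. *)
From Stdlib Require Import FunctionalExtensionality PropExtensionality.
From Stdlib Require Import ProofIrrelevance IndefiniteDescription.

Set Implicit Arguments.
Unset Strict Implicit.

Definition the {A : Type} {P : A -> Prop} (H : exists! x, P x) : A :=
  proj1_sig (constructive_indefinite_description _ H).

Lemma the_spec {A : Type} {P : A -> Prop} (H : exists! x, P x) : P (the H).
Proof.
  exact (proj1 (proj2_sig (constructive_indefinite_description _ H))).
Qed.

Lemma the_uniq {A : Type} {P : A -> Prop} (H : exists! x, P x) (y : A) :
  P y -> y = the H.
Proof.
  intro Hy; symmetry.
  exact (proj2 (proj2_sig (constructive_indefinite_description _ H)) y Hy).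
Qed.

Lemma exists_unique_eq {A : Type} {P : A -> Prop} (H : exists! x, P x) (y z : A) :
  P y -> P z -> y = z.
Proof.
  intros Hy Hz; rewrite (the_uniq H Hy); symmetry; exact (the_uniq H Hz).
Qed.

Lemma sig_eq {A : Type} {P : A -> Prop} (x y : {a : A | P a}) :
  proj1_sig x = proj1_sig y -> x = y.
Proof.
  destruct x as [x px], y as [y py]; simpl; intro e; subst y.
  now rewrite (proof_irrelevance _ px py).
Qed.

Record Category : Type := {
  ob :> Type;
  hom : ob -> ob -> Type;
  idm : forall x, hom x x;
  comp : forall x y z, hom y z -> hom x y -> hom x z;
  comp_id_l : forall x y (f : hom x y), comp (idm y) f = f;
  comp_id_r : forall x y (f : hom x y), comp f (idm x) = f;
  comp_assoc : forall x y z w (h : hom z w) (g : hom y z) (f : hom x y),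
    comp h (comp g f) = comp (comp h g) f }.

Arguments hom {_} _ _.
Arguments idm {_} _.
Arguments comp {_ _ _ _} _ _.

Notation "g ∘ f" := (comp g f) (at level 40, left associativity).

Record Functor (C D : Category) : Type := {
  fob :> C -> D;
  fmap : forall x y : C, hom x y -> hom (fob x) (fob y);
  fmap_id : forall x : C, fmap (idm x) = idm (fob x);
  fmap_comp : forall (x y z : C) (g : hom y z) (f : hom x y),
    fmap (g ∘ f) = fmap g ∘ fmap f }.

Arguments fmap {_ _} _ {_ _} _.

Definition IsIso {C : Category} {x y : C} (f : hom x y) : Prop :=
  exists g : hom y x, g ∘ f = idm x /\ f ∘ g = idm y.

Definition Isomorphic {C : Category} (x y : C) : Prop :=
  exists f : hom x y, IsIso f.

Definition Mono {C : Category} {x y : C} (f : hom x y) : Prop :=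
  forall (t : C) (a b : hom t x), f ∘ a = f ∘ b -> a = b.

Definition IsUniversalArrow {C D : Category} (F : Functor C D) (x : D)
    (d : C) (u : hom (F d) x) : Prop :=
  forall (q : C) (v : hom (F q) x), exists! h : hom q d, u ∘ fmap F h = v.

Record UniversalArrow {C D : Category} (F : Functor C D) (x : D) : Type := {
  ua_ob : C;
  ua_arr : hom (F ua_ob) x;
  ua_univ : IsUniversalArrow ua_arr }.

Arguments ua_ob {_ _ _ _} _.
Arguments ua_arr {_ _ _ _} _.

(** A right adjoint, given objectwise by its counit. *)
Definition RightAdjoint {C D : Category} (F : Functor C D) : Type :=
  forall x : D, UniversalArrow F x.

Definition IsTerminal {C : Category} (t : C) : Prop :=
  forall x : C, exists! f : hom x t, True.

Definition IsInitial {C : Category} (z : C) : Prop :=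
  forall x : C, exists! f : hom z x, True.

Definition IsCoproduct {C : Category} {a b s : C} (i : hom a s) (j : hom b s) : Prop :=
  forall (t : C) (f : hom a t) (g : hom b t),
    exists! h : hom s t, h ∘ i = f /\ h ∘ j = g.

(** The square with [f ∘ p = g ∘ q] is a pullback. *)
Definition IsPullback {C : Category} {w x y z : C}
    (p : hom w x) (q : hom w y) (f : hom x z) (g : hom y z) : Prop :=
  f ∘ p = g ∘ q /\
  forall (t : C) (a : hom t x) (b : hom t y), f ∘ a = g ∘ b ->
    exists! h : hom t w, p ∘ h = a /\ q ∘ h = b.

Record Terminal (C : Category) : Type := {
  one : C;
  one_terminal : IsTerminal one }.

Arguments one {_} _.

Record Pullback {C : Category} {x y z : C} (f : hom x z) (g : hom y z) : Type := {
  pb_ob : C;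
  pb_fst : hom pb_ob x;
  pb_snd : hom pb_ob y;
  pb_is : IsPullback pb_fst pb_snd f g }.

Arguments pb_ob {_ _ _ _ _ _} _.
Arguments pb_fst {_ _ _ _ _ _} _.
Arguments pb_snd {_ _ _ _ _ _} _.
Arguments pb_is {_ _ _ _ _ _} _.

Definition HasPullbacks (C : Category) : Type :=
  forall (x y z : C) (f : hom x z) (g : hom y z), Pullback f g.

Record FiniteSums (C : Category) : Type := {
  zero : C;
  zero_initial : IsInitial zero;
  sum : C -> C -> C;
  inl : forall a b : C, hom a (sum a b);
  inr : forall a b : C, hom b (sum a b);
  sum_coproduct : forall a b : C, IsCoproduct (inl a b) (inr a b) }.

Arguments zero {_} _.
Arguments zero_initial {_} _ _.
Arguments sum {_} _ _ _.
Arguments inl {_} _ _ _.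
Arguments inr {_} _ _ _.
Arguments sum_coproduct {_} _ _ _ _ _ _.

Section Sums.
Context {C : Category} (S : FiniteSums C).

Definition from_zero (x : C) : hom (zero S) x := the (zero_initial S x).

Definition copair {a b t : C} (f : hom a t) (g : hom b t) : hom (sum S a b) t :=
  the (sum_coproduct S a b t f g).

Definition sum_map {a b a' b' : C} (f : hom a a') (g : hom b b') :
    hom (sum S a b) (sum S a' b') :=
  copair (inl S a' b' ∘ f) (inr S a' b' ∘ g).

Definition DisjointSums : Prop :=
  forall a b : C,
    Mono (inl S a b) /\ Mono (inr S a b) /\
    IsPullback (from_zero a) (from_zero b) (inl S a b) (inr S a b).

(** Pulling back along any [f] preserves binary sums in the slice; this is what
    makes [(-) * 1] act on cartesian squares, and it is automatic in a locally
    cartesian closed category (see [lcc_stable_sums]). *)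
Definition StableSums : Prop :=
  forall (y z x1 x2 w1 w2 : C) (f : hom y z)
    (d1 : hom x1 z) (d2 : hom x2 z)
    (p1 : hom w1 x1) (q1 : hom w1 y) (p2 : hom w2 x2) (q2 : hom w2 y),
    IsPullback p1 q1 d1 f -> IsPullback p2 q2 d2 f ->
    IsPullback (sum_map p1 p2) (copair q1 q2) (copair d1 d2) f.

Lemma copair_inl {a b t : C} (f : hom a t) (g : hom b t) :
  copair f g ∘ inl S a b = f.
Proof. exact (proj1 (the_spec (sum_coproduct S a b t f g))). Qed.

Lemma copair_inr {a b t : C} (f : hom a t) (g : hom b t) :
  copair f g ∘ inr S a b = g.
Proof. exact (proj2 (the_spec (sum_coproduct S a b t f g))). Qed.

Lemma sum_ext {a b t : C} (h k : hom (sum S a b) t) :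
  h ∘ inl S a b = k ∘ inl S a b -> h ∘ inr S a b = k ∘ inr S a b -> h = k.
Proof.
  intros e1 e2.
  apply (exists_unique_eq (sum_coproduct S a b t (k ∘ inl S a b) (k ∘ inr S a b)));
    auto.
Qed.

Lemma sum_map_id (a b : C) : sum_map (idm a) (idm b) = idm (sum S a b).
Proof.
  apply sum_ext; unfold sum_map; rewrite ?copair_inl, ?copair_inr;
    now rewrite comp_id_l, comp_id_r.
Qed.

Lemma sum_map_comp {a b a' b' a'' b'' : C} (f' : hom a' a'') (g' : hom b' b'')
    (f : hom a a') (g : hom b b') :
  sum_map (f' ∘ f) (g' ∘ g) = sum_map f' g' ∘ sum_map f g.
Proof.
  apply sum_ext; unfold sum_map; rewrite <- comp_assoc, ?copair_inl, ?copair_inr;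
    now rewrite !comp_assoc, ?copair_inl, ?copair_inr.
Qed.

End Sums.

Section Slice.
Context {C : Category} (b : C).

Record SliceOb : Type := mkSlice { sl_dom : C; sl_arr : hom sl_dom b }.

Definition SliceHom (x y : SliceOb) : Type :=
  {m : hom (sl_dom x) (sl_dom y) | sl_arr y ∘ m = sl_arr x}.

Program Definition Slice : Category := {|
  ob := SliceOb;
  hom := SliceHom;
  idm := fun x => idm (sl_dom x);
  comp := fun x y z g f => proj1_sig g ∘ proj1_sig f |}.
Next Obligation. apply comp_id_r. Qed.
Next Obligation.
  destruct g as [g eg], f as [f ef]; simpl.
  now rewrite comp_assoc, eg.
Qed.
Next Obligation. apply sig_eq; apply comp_id_l. Qed.
Next Obligation. apply sig_eq; apply comp_id_r. Qed.
Next Obligation. apply sig_eq; apply comp_assoc. Qed.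

End Slice.

Arguments mkSlice {_ _ _} _.

Section PullbackFunctor.
Context {C : Category} (PB : HasPullbacks C) {e b : C} (p : hom e b).

Definition delta_ob (x : Slice b) : Slice e :=
  mkSlice (pb_snd (PB (sl_arr x) p)).

Lemma delta_map_ex (x y : Slice b) (m : hom x y) :
  exists! h : hom (pb_ob (PB (sl_arr x) p)) (pb_ob (PB (sl_arr y) p)),
    pb_fst (PB (sl_arr y) p) ∘ h = proj1_sig m ∘ pb_fst (PB (sl_arr x) p) /\
    pb_snd (PB (sl_arr y) p) ∘ h = pb_snd (PB (sl_arr x) p).
Proof.
  apply (proj2 (pb_is (PB (sl_arr y) p))).
  rewrite comp_assoc, (proj2_sig m).
  exact (proj1 (pb_is (PB (sl_arr x) p))).
Qed.

Definition delta_map (x y : Slice b) (m : hom x y) : hom (delta_ob x) (delta_ob y) :=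
  exist _ (the (delta_map_ex m)) (proj2 (the_spec (delta_map_ex m))).

Program Definition delta : Functor (Slice b) (Slice e) := {|
  fob := delta_ob;
  fmap := delta_map |}.
Next Obligation.
  apply sig_eq; simpl; symmetry; apply the_uniq; simpl.
  now rewrite comp_id_l, !comp_id_r.
Qed.
Next Obligation.
  apply sig_eq; simpl; symmetry; apply the_uniq; simpl.
  destruct (the_spec (delta_map_ex f)) as [f1 f2].
  destruct (the_spec (delta_map_ex g)) as [g1 g2].
  split.
  - now rewrite comp_assoc, g1, <- !comp_assoc, f1.
  - now rewrite comp_assoc, g2, f2.
Qed.

End PullbackFunctor.

Record LocallyCartesianClosed (C : Category) : Type := {
  lcc_pb : HasPullbacks C;
  lcc_pi : forall (e b : C) (p : hom e b), RightAdjoint (delta lcc_pb p) }.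

Arguments lcc_pb {_} _ {_ _ _} _ _.
Arguments lcc_pi {_} _ {_ _} _ _.

Definition Pi {C : Category} (L : LocallyCartesianClosed C) {e b : C} (p : hom e b)
    (x : Slice e) : Slice b := ua_ob (lcc_pi L p x).

Definition MorphismClass (C : Category) : Type := forall x y : C, hom x y -> Prop.

Section Dense.
Context {C : Category} (L : LocallyCartesianClosed C) (S : FiniteSums C).

Definition neg {x y : C} (q : hom x y) : Slice y :=
  Pi L q (mkSlice (from_zero S x)).

Definition Dense {a b : C} (f : hom a b) : Prop :=
  @Isomorphic (Slice b) (neg (sl_arr (neg f))) (mkSlice (idm b)).

Definition DenseMono : MorphismClass C := fun a b f => Mono f /\ Dense f.

End Dense.

Section Localization.
Context (C : Category) (W : MorphismClass C).

(** [C[W^-1]]: the objects of [C], with formal zigzags modulo the least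
    congruence that makes [C -> C[W^-1]] a functor and inverts [W]. *)

Inductive Zig : C -> C -> Type :=
| zmap : forall x y, hom x y -> Zig x y
| zinv : forall x y (w : hom x y), W w -> Zig y x
| zcomp : forall x y z, Zig y z -> Zig x y -> Zig x z.

Inductive ZigEq : forall x y, Zig x y -> Zig x y -> Prop :=
| ze_refl : forall x y (a : Zig x y), ZigEq a a
| ze_sym : forall x y (a b : Zig x y), ZigEq a b -> ZigEq b a
| ze_trans : forall x y (a b c : Zig x y), ZigEq a b -> ZigEq b c -> ZigEq a c
| ze_cong : forall x y z (a a' : Zig y z) (b b' : Zig x y),
    ZigEq a a' -> ZigEq b b' -> ZigEq (zcomp a b) (zcomp a' b')
| ze_assoc : forall x y z t (c : Zig z t) (b : Zig y z) (a : Zig x y),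
    ZigEq (zcomp c (zcomp b a)) (zcomp (zcomp c b) a)
| ze_id_l : forall x y (a : Zig x y), ZigEq (zcomp (zmap (idm y)) a) a
| ze_id_r : forall x y (a : Zig x y), ZigEq (zcomp a (zmap (idm x))) a
| ze_map : forall x y z (g : hom y z) (f : hom x y),
    ZigEq (zcomp (zmap g) (zmap f)) (zmap (g ∘ f))
| ze_inv_l : forall x y (w : hom x y) (Hw : W w),
    ZigEq (zcomp (zinv Hw) (zmap w)) (zmap (idm x))
| ze_inv_r : forall x y (w : hom x y) (Hw : W w),
    ZigEq (zcomp (zmap w) (zinv Hw)) (zmap (idm y)).

(** Hom-sets are quotients: a class of zigzags is its membership predicate. *)
Definition LocHom (x y : C) : Type :=
  {P : Zig x y -> Prop | exists a, P = ZigEq a}.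

Definition zclass {x y : C} (a : Zig x y) : LocHom x y :=
  exist _ (ZigEq a) (ex_intro _ a eq_refl).

Lemma zclass_eq {x y : C} (a b : Zig x y) : ZigEq a b -> zclass a = zclass b.
Proof.
  intro H; apply sig_eq; simpl.
  apply functional_extensionality; intro c; apply propositional_extensionality.
  split; intro K.
  - exact (ze_trans (ze_sym H) K).
  - exact (ze_trans H K).
Qed.

Lemma zclass_surj {x y : C} (P : LocHom x y) : exists a, P = zclass a.
Proof. destruct P as [P [a e]]; exists a; apply sig_eq; exact e. Qed.

Definition loc_comp_pred {x y z : C} (Q : LocHom y z) (P : LocHom x y)
    (c : Zig x z) : Prop :=
  exists b a, proj1_sig Q b /\ proj1_sig P a /\ ZigEq (zcomp b a) c.

Lemma loc_comp_pred_zclass {x y z : C} (b : Zig y z) (a : Zig x y) :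
  loc_comp_pred (zclass b) (zclass a) = ZigEq (zcomp b a).
Proof.
  apply functional_extensionality; intro c; apply propositional_extensionality.
  split.
  - intros [b' [a' [Hb [Ha H]]]]; simpl in Hb, Ha.
    exact (ze_trans (ze_cong Hb Ha) H).
  - intro H; exists b, a; simpl; auto using ze_refl.
Qed.

Lemma loc_comp_pred_class {x y z : C} (Q : LocHom y z) (P : LocHom x y) :
  exists c, loc_comp_pred Q P = ZigEq c.
Proof.
  destruct (zclass_surj Q) as [b ->], (zclass_surj P) as [a ->].
  exists (zcomp b a); apply loc_comp_pred_zclass.
Qed.

Definition loc_comp {x y z : C} (Q : LocHom y z) (P : LocHom x y) : LocHom x z :=
  exist _ (loc_comp_pred Q P) (loc_comp_pred_class Q P).

Lemma loc_comp_zclass {x y z : C} (b : Zig y z) (a : Zig x y) :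
  loc_comp (zclass b) (zclass a) = zclass (zcomp b a).
Proof. apply sig_eq; apply loc_comp_pred_zclass. Qed.

Program Definition Localization : Category := {|
  ob := ob C;
  hom := LocHom;
  idm := fun x => zclass (zmap (idm x));
  comp := fun x y z Q P => loc_comp Q P |}.
Next Obligation.
  destruct (zclass_surj f) as [a ->]; rewrite loc_comp_zclass.
  apply zclass_eq, ze_id_l.
Qed.
Next Obligation.
  destruct (zclass_surj f) as [a ->]; rewrite loc_comp_zclass.
  apply zclass_eq, ze_id_r.
Qed.
Next Obligation.
  destruct (zclass_surj f) as [a ->], (zclass_surj g) as [b ->],
    (zclass_surj h) as [c ->].
  rewrite !loc_comp_zclass; apply zclass_eq, ze_assoc.
Qed.

Program Definition loc : Functor C Localization := {|
  fob := fun x => x;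
  fmap := fun x y f => zclass (zmap f) |}.
Next Obligation.
  rewrite loc_comp_zclass; apply zclass_eq, ze_sym, ze_map.
Qed.

Lemma loc_inverts {x y : C} (w : hom x y) : W w -> IsIso (fmap loc w).
Proof.
  intro Hw; exists (zclass (zinv Hw) : @hom Localization y x); simpl.
  rewrite !loc_comp_zclass; split; apply zclass_eq.
  - apply ze_inv_l.
  - apply ze_inv_r.
Qed.

End Localization.

Lemma pullback_id {C : Category} {x y : C} (f : hom x y) :
  IsPullback (idm x) f f (idm y).
Proof.
  split.
  - now rewrite comp_id_l, comp_id_r.
  - intros t a b H; exists a; split.
    + now rewrite comp_id_l in *.
    + intros h [H1 _]; now rewrite comp_id_l in H1.
Qed.

Lemma pullback_paste {C : Category} {x0 x1 x2 y0 y1 y2 : C}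
    {p0 : hom x0 y0} {p1 : hom x1 y1} {p2 : hom x2 y2}
    {f : hom x0 x1} {f' : hom x1 x2} {g : hom y0 y1} {g' : hom y1 y2} :
  IsPullback f' p1 p2 g' -> IsPullback f p0 p1 g ->
  IsPullback (f' ∘ f) p0 p2 (g' ∘ g).
Proof.
  intros [c' u'] [c u]; split.
  - now rewrite comp_assoc, c', <- comp_assoc, c, comp_assoc.
  - intros t a b H.
    rewrite <- comp_assoc in H.
    destruct (u' t a (g ∘ b) H) as [k [[k1 k2] ku]].
    destruct (u t k b k2) as [h [[h1 h2] hu]].
    exists h; split.
    + split; [now rewrite <- comp_assoc, h1 | exact h2].
    + intros h' [e1 e2]; apply hu; split; [|exact e2].
      symmetry; apply ku; split.
      * now rewrite comp_assoc.
      * now rewrite comp_assoc, c, <- comp_assoc, e2.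
Qed.

Record ArrOb (C : Category) : Type :=
  mkArr { ar_dom : C; ar_cod : C; ar_arr : hom ar_dom ar_cod }.

Arguments ar_dom {_} _.
Arguments ar_cod {_} _.
Arguments ar_arr {_} _.
Arguments mkArr {_ _ _} _.

Record CartSquare {C : Category} (p q : ArrOb C) : Type := mkSquare {
  sq_dom : hom (ar_dom p) (ar_dom q);
  sq_cod : hom (ar_cod p) (ar_cod q);
  sq_pb : IsPullback sq_dom (ar_arr p) (ar_arr q) sq_cod }.

Lemma square_eq {C : Category} {p q : ArrOb C} (f g : CartSquare p q) :
  sq_dom f = sq_dom g -> sq_cod f = sq_cod g -> f = g.
Proof.
  destruct f as [f1 f2 fp], g as [g1 g2 gp]; simpl; intros; subst.
  now rewrite (proof_irrelevance _ fp gp).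
Qed.

(** The hom-category [Poly C (1,1)]; the legs [1 <- e] and [b -> 1] carry no
    information and are omitted. *)
Program Definition Poly11 (C : Category) : Category := {|
  ob := ArrOb C;
  hom := CartSquare;
  idm := fun p => mkSquare (pullback_id (ar_arr p));
  comp := fun p q r g f => mkSquare (pullback_paste (sq_pb g) (sq_pb f)) |}.
Next Obligation. apply square_eq; apply comp_id_l. Qed.
Next Obligation. apply square_eq; apply comp_id_r. Qed.
Next Obligation. apply square_eq; apply comp_assoc. Qed.

Section Star.
Context {C : Category} (S : FiniteSums C) (St : StableSums S).

Definition star1_ob (p : Poly11 C) : Poly11 C :=
  mkArr (copair S (ar_arr p) (idm (ar_cod p))).

Lemma pullback_id_both {x y : C} (f : hom x y) :
  IsPullback f (idm x) (idm y) f.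
Proof.
  split.
  - now rewrite comp_id_l, comp_id_r.
  - intros t a b H; exists b; split.
    + now rewrite !comp_id_l in *.
    + intros h [_ H2]; now rewrite comp_id_l in H2.
Qed.

Definition star1_map (p q : Poly11 C) (f : hom p q) : hom (star1_ob p) (star1_ob q) :=
  @mkSquare C (star1_ob p) (star1_ob q) (sum_map S (sq_dom f) (sq_cod f)) (sq_cod f)
    (St (sq_pb f) (pullback_id_both (sq_cod f))).

Program Definition star1 : Functor (Poly11 C) (Poly11 C) := {|
  fob := star1_ob;
  fmap := star1_map |}.
Next Obligation.
  apply square_eq; simpl; [apply sum_map_id | reflexivity].
Qed.
Next Obligation.
  apply square_eq; simpl; [apply sum_map_comp | reflexivity].
Qed.

Definition IsDerivative (p d : Poly11 C) (u : hom (star1 d) p) : Prop :=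
  IsUniversalArrow u.

End Star.

Arguments star1 {_} S St.
Arguments IsDerivative {_ S} St p d u.

Lemma left_adjoint_coproduct {C D : Category} (F : Functor C D) (R : RightAdjoint F)
    {a b s : C} (i : hom a s) (j : hom b s) :
  IsCoproduct i j -> IsCoproduct (fmap F i) (fmap F j).
Proof.
  intros H t f g.
  pose proof (ua_univ (R t)) as U; set (u := ua_arr (R t)) in *.
  destruct (U a f) as [f' [ef uf]], (U b g) as [g' [eg ug]].
  destruct (H _ f' g') as [h [[h1 h2] hu]].
  exists (u ∘ fmap F h); split.
  - split; rewrite <- comp_assoc, <- fmap_comp; [now rewrite h1 | now rewrite h2].
  - intros k [k1 k2]; destruct (U s k) as [k' [ek uk]].
    rewrite <- ek; do 2 f_equal; apply hu; split; symmetry.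
    + apply uf; now rewrite fmap_comp, comp_assoc, ek.
    + apply ug; now rewrite fmap_comp, comp_assoc, ek.
Qed.

Lemma pullback_ext {C : Category} {w x y z : C}
    {p : hom w x} {q : hom w y} {f : hom x z} {g : hom y z}
    (H : IsPullback p q f g) {t : C} (h k : hom t w) :
  p ∘ h = p ∘ k -> q ∘ h = q ∘ k -> h = k.
Proof.
  intros e1 e2; destruct H as [c u].
  refine (exists_unique_eq (u t (p ∘ k) (q ∘ k) _) _ _); auto.
  now rewrite !comp_assoc, c.
Qed.

Lemma pullback_iso {C : Category} {w v x y z : C}
    {p : hom w x} {q : hom w y} {f : hom x z} {g : hom y z} (k : hom v w) :
  IsIso k -> IsPullback p q f g -> IsPullback (p ∘ k) (q ∘ k) f g.
Proof.
  intros [m [mk km]] [c u]; split.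
  - now rewrite !comp_assoc, c.
  - intros t a b H; destruct (u t a b H) as [h [[h1 h2] hu]].
    exists (m ∘ h); split.
    + split; rewrite comp_assoc, <- (comp_assoc _ k m), km, comp_id_r; assumption.
    + intros h' [e1 e2]; rewrite (hu (k ∘ h')).
      * now rewrite comp_assoc, mk, comp_id_l.
      * now rewrite !comp_assoc.
Qed.

Lemma slice_coproduct {C : Category} (S : FiniteSums C) {z x1 x2 : C}
    (d1 : hom x1 z) (d2 : hom x2 z) :
  @IsCoproduct (Slice z) (mkSlice d1) (mkSlice d2) (mkSlice (copair S d1 d2))
    (exist _ (inl S x1 x2) (copair_inl S d1 d2))
    (exist _ (inr S x1 x2) (copair_inr S d1 d2)).
Proof.
  intros [t dt] [f ef] [g eg]; simpl in *.
  assert (e : dt ∘ copair S f g = copair S d1 d2).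
  { apply sum_ext; rewrite <- comp_assoc, ?copair_inl, ?copair_inr; assumption. }
  exists (exist _ (copair S f g) e); split.
  - split; apply sig_eq; simpl; [apply copair_inl | apply copair_inr].
  - intros [h eh] [h1 h2]; apply sig_eq; simpl.
    apply (f_equal (@proj1_sig _ _)) in h1; apply (f_equal (@proj1_sig _ _)) in h2.
    simpl in h1, h2; subst f g.
    apply sum_ext; now rewrite ?copair_inl, ?copair_inr.
Qed.

Lemma lcc_stable_sums {C : Category} (L : LocallyCartesianClosed C)
    (S : FiniteSums C) : StableSums S.
Proof.
  intros y z x1 x2 w1 w2 f d1 d2 p1 q1 p2 q2 H1 H2.
  set (Z := lcc_pb L (copair S d1 d2) f).
  set (Z1 := lcc_pb L d1 f); set (Z2 := lcc_pb L d2 f).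
  pose proof (left_adjoint_coproduct (lcc_pi L f) (@slice_coproduct C S z x1 x2 d1 d2)) as HC.
  set (I1 := fmap _ _) in HC; set (I2 := fmap _ _) in HC.
  set (J1 := proj1_sig I1 : hom (pb_ob Z1) (pb_ob Z)).
  set (J2 := proj1_sig I2 : hom (pb_ob Z2) (pb_ob Z)).
  assert (EI1 : pb_fst Z ∘ J1 = inl S x1 x2 ∘ pb_fst Z1 /\
                pb_snd Z ∘ J1 = pb_snd Z1).
  { exact (the_spec (@delta_map_ex C (@lcc_pb C L) y z f
             (mkSlice d1) (mkSlice (copair S d1 d2)) _)). }
  assert (EI2 : pb_fst Z ∘ J2 = inr S x1 x2 ∘ pb_fst Z2 /\
                pb_snd Z ∘ J2 = pb_snd Z2).
  { exact (the_spec (@delta_map_ex C (@lcc_pb C L) y z f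
             (mkSlice d2) (mkSlice (copair S d1 d2)) _)). }
  destruct (proj2 H1 _ (pb_fst Z1) (pb_snd Z1) (proj1 (pb_is Z1))) as [a1 [[a1f a1s] _]].
  destruct (proj2 H2 _ (pb_fst Z2) (pb_snd Z2) (proj1 (pb_is Z2))) as [a2 [[a2f a2s] _]].
  destruct (proj2 (pb_is Z1) _ p1 q1 (proj1 H1)) as [b1 [[b1f b1s] _]].
  destruct (proj2 (pb_is Z2) _ p2 q2 (proj1 H2)) as [b2 [[b2f b2s] _]].
  assert (b1a1 : a1 ∘ b1 = idm w1).
  { apply (pullback_ext H1); rewrite comp_assoc, comp_id_r.
    - now rewrite a1f. - now rewrite a1s. }
  assert (b2a2 : a2 ∘ b2 = idm w2).
  { apply (pullback_ext H2); rewrite comp_assoc, comp_id_r.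
    - now rewrite a2f. - now rewrite a2s. }
  assert (a1b1 : b1 ∘ a1 = idm _).
  { apply (pullback_ext (pb_is Z1)); rewrite comp_assoc, comp_id_r.
    - now rewrite b1f. - now rewrite b1s. }
  assert (a2b2 : b2 ∘ a2 = idm _).
  { apply (pullback_ext (pb_is Z2)); rewrite comp_assoc, comp_id_r.
    - now rewrite b2f. - now rewrite b2s. }
  set (k := copair S (J1 ∘ b1) (J2 ∘ b2)).
  assert (kf : pb_fst Z ∘ k = sum_map S p1 p2).
  { unfold k, sum_map; apply sum_ext;
      rewrite <- comp_assoc, ?copair_inl, ?copair_inr, comp_assoc.
    - now rewrite (proj1 EI1), <- comp_assoc, b1f.
    - now rewrite (proj1 EI2), <- comp_assoc, b2f. }
  assert (ks : pb_snd Z ∘ k = copair S q1 q2).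
  { unfold k; apply sum_ext;
      rewrite <- comp_assoc, ?copair_inl, ?copair_inr, comp_assoc.
    - now rewrite (proj2 EI1).
    - now rewrite (proj2 EI2). }
  set (V := mkSlice (copair S q1 q2) : Slice y).
  assert (e1 : sl_arr V ∘ (inl S w1 w2 ∘ a1) = pb_snd Z1).
  { simpl; now rewrite comp_assoc, copair_inl. }
  assert (e2 : sl_arr V ∘ (inr S w1 w2 ∘ a2) = pb_snd Z2).
  { simpl; now rewrite comp_assoc, copair_inr. }
  destruct (HC V (exist _ _ e1) (exist _ _ e2)) as [m [[m1 m2] _]].
  apply (f_equal (@proj1_sig _ _)) in m1; apply (f_equal (@proj1_sig _ _)) in m2.
  set (M := proj1_sig m : hom (pb_ob Z) (sum S w1 w2)).
  assert (M1 : M ∘ J1 = inl S w1 w2 ∘ a1) by exact m1.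
  assert (M2 : M ∘ J2 = inr S w1 w2 ∘ a2) by exact m2.
  assert (Hk : IsIso k).
  { exists M; split.
    - unfold k; apply sum_ext;
        rewrite <- comp_assoc, ?copair_inl, ?copair_inr, comp_id_l, comp_assoc.
      + now rewrite M1, <- comp_assoc, b1a1, comp_id_r.
      + now rewrite M2, <- comp_assoc, b2a2, comp_id_r.
    - assert (ek : pb_snd Z ∘ (k ∘ M) = pb_snd Z).
      { rewrite comp_assoc, ks; exact (proj2_sig m). }
      set (T := delta_ob (@lcc_pb C L) f (mkSlice (copair S d1 d2)) : Slice y).
      set (km := exist _ (k ∘ M) ek : hom T T).
      change (proj1_sig km = proj1_sig (idm T)).
      f_equal.
      apply (exists_unique_eq (HC T I1 I2)); split; apply sig_eq; simpl.
      + change (k ∘ M ∘ J1 = J1).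
        now rewrite <- comp_assoc, M1, comp_assoc; unfold k;
          rewrite copair_inl, <- comp_assoc, a1b1, comp_id_r.
      + change (k ∘ M ∘ J2 = J2).
        now rewrite <- comp_assoc, M2, comp_assoc; unfold k;
          rewrite copair_inr, <- comp_assoc, a2b2, comp_id_r.
      + apply comp_id_l.
      + apply comp_id_l. }
  rewrite <- kf, <- ks; exact (pullback_iso Hk (pb_is Z)).
Qed.

Definition PreservesPullbacks {C D : Category} (F : Functor C D) : Prop :=
  forall (w x y z : C) (p : hom w x) (q : hom w y) (f : hom x z) (g : hom y z),
    IsPullback p q f g ->
    IsPullback (fmap F p) (fmap F q) (fmap F f) (fmap F g).

Definition PreservesFiniteSums {C D : Category} (S : FiniteSums C) (F : Functor C D) :
    Prop :=
  IsInitial (F (zero S)) /\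
  forall a b : C, IsCoproduct (fmap F (inl S a b)) (fmap F (inr S a b)).

(** A distributivity pullback around [x -g-> e -p-> b] is a terminal diagram
    [z -i-> x], [z -q-> y], [y -r-> b] in which [(g ∘ i, q, p, r)] is a pullback. *)
Definition IsDistributivityPullback {C : Category} {x e b z y : C}
    (g : hom x e) (p : hom e b) (i : hom z x) (q : hom z y) (r : hom y b) : Prop :=
  IsPullback (g ∘ i) q p r /\
  forall (z' y' : C) (i' : hom z' x) (q' : hom z' y') (r' : hom y' b),
    IsPullback (g ∘ i') q' p r' ->
    exists! h : hom z' z * hom y' y,
      i ∘ fst h = i' /\ q ∘ fst h = snd h ∘ q' /\ r ∘ snd h = r'.

Definition PreservesDistributivityPullbacks {C D : Category} (F : Functor C D) : Prop :=
  forall (x e b z y : C) (g : hom x e) (p : hom e b)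
    (i : hom z x) (q : hom z y) (r : hom y b),
    IsDistributivityPullback g p i q r ->
    IsDistributivityPullback (fmap F g) (fmap F p) (fmap F i) (fmap F q) (fmap F r).

Section Poly11Map.
Context {C D : Category} (F : Functor C D) (Fpb : PreservesPullbacks F).

Definition Poly11_map_ob (p : Poly11 C) : Poly11 D := mkArr (fmap F (ar_arr p)).

Definition Poly11_map_hom (p q : Poly11 C) (f : hom p q) :
    hom (Poly11_map_ob p) (Poly11_map_ob q) :=
  @mkSquare D (Poly11_map_ob p) (Poly11_map_ob q)
    (fmap F (sq_dom f)) (fmap F (sq_cod f)) (Fpb (sq_pb f)).

(** The action on [Poly(1,1)] of the pseudofunctor [Poly C -> Poly D] induced by [F]. *)
Program Definition Poly11_map : Functor (Poly11 C) (Poly11 D) := {|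
  fob := Poly11_map_ob;
  fmap := Poly11_map_hom |}.
Next Obligation. apply square_eq; apply fmap_id. Qed.
Next Obligation. apply square_eq; apply fmap_comp. Qed.

Context (SC : FiniteSums C) (StC : StableSums SC).
Context (SD : FiniteSums D) (StD : StableSums SD).
Context (Fsum : PreservesFiniteSums SC F).

Definition sum_comparison (a b : C) : hom (sum SD (F a) (F b)) (F (sum SC a b)) :=
  copair SD (fmap F (inl SC a b)) (fmap F (inr SC a b)).

Lemma sum_comparison_iso (a b : C) : IsIso (sum_comparison a b).
Proof.
  destruct (proj2 Fsum a b _ (inl SD (F a) (F b)) (inr SD (F a) (F b)))
    as [m [[m1 m2] _]].
  unfold sum_comparison; exists m; split.
  - apply sum_ext; rewrite <- comp_assoc, ?copair_inl, ?copair_inr, comp_id_l; assumption.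
  - apply (exists_unique_eq
             (proj2 Fsum a b _ (fmap F (inl SC a b)) (fmap F (inr SC a b))));
      split; rewrite ?comp_id_l, <- ?comp_assoc, ?m1, ?m2, ?copair_inl, ?copair_inr;
      reflexivity.
Qed.

Lemma star1_comparison_pb (d : Poly11 C) :
  IsPullback (sum_comparison (ar_dom d) (ar_cod d))
    (copair SD (fmap F (ar_arr d)) (idm (F (ar_cod d))))
    (fmap F (copair SC (ar_arr d) (idm (ar_cod d)))) (idm (F (ar_cod d))).
Proof.
  set (c := fmap F (copair SC (ar_arr d) (idm (ar_cod d)))).
  pose proof (pullback_iso (sum_comparison_iso (ar_dom d) (ar_cod d)) (pullback_id c)) as H.
  rewrite comp_id_l in H.
  replace (copair SD (fmap F (ar_arr d)) (idm (F (ar_cod d))))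
    with (c ∘ sum_comparison (ar_dom d) (ar_cod d)); [exact H|].
  unfold c, sum_comparison; apply sum_ext;
    rewrite <- comp_assoc, ?copair_inl, ?copair_inr, <- fmap_comp, ?copair_inl, ?copair_inr.
  - reflexivity.
  - apply fmap_id.
Qed.

(** The canonical 2-cell [F d * 1 -> F (d * 1)]. *)
Definition star1_comparison (d : Poly11 C) :
    hom (star1 SD StD (Poly11_map d)) (Poly11_map (star1 SC StC d)) :=
  @mkSquare D (star1 SD StD (Poly11_map d)) (Poly11_map (star1 SC StC d))
    (sum_comparison (ar_dom d) (ar_cod d)) (idm (F (ar_cod d)))
    (star1_comparison_pb d).

Definition PreservesDerivatives : Prop :=
  forall (p d : Poly11 C) (u : hom (star1 SC StC d) p),
    IsDerivative StC p d u ->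
    IsDerivative StD (Poly11_map p) (Poly11_map d)
      (fmap Poly11_map u ∘ star1_comparison d).

End Poly11Map.

Arguments PreservesDerivatives {_ _} F Fpb SC StC SD StD Fsum.

(* Main.v *)
Require Import Defs.

(* A cartesian square [u : d * 1 -> p], for [p : E -> B] and [d : F -> A], amounts to a point
   [e : A -> E] together with a complement [F] of the section of [A ×_B E -> A] that [e]
   induces; this section is the pullback along [e] of the diagonal [E -> E ×_B E].  Hence [u]
   is a derivative as soon as [e] is invertible, and in general exactly when [e] is universal
   among the maps along which the diagonal becomes complemented.  Writing [N] for the negation
   of the diagonal and [m : N + E -> E ×_B E], the latter says that [e] is the result of
   applying [Pi] along the projection [E ×_B E -> E] to [m].  Now [m] is a dense
   monomorphism, so it is inverted by the localization: there [N -> E] is a derivative with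
   [e = 1], and a functor preserving distributivity pullbacks and inverting [m] makes the
   point of any derivative invertible.

   The localization is computed by partial maps with dense domain: every arrow [P] satisfies
   [P ∘ Q w = Q g] with [w] a dense monomorphism, and [Q f = Q g] forces [f ∘ w = g ∘ w] for
   some dense monomorphism [w]. *)

Set Implicit Arguments.
Unset Strict Implicit.

(** * Pullbacks and sums *)

Section Pullbacks.
Context {C : Category}.

Lemma id_iso (x : C) : IsIso (idm x).
Proof. exists (idm x); split; apply comp_id_l. Qed.

Lemma retract_mono {x y : C} (f : hom x y) (g : hom y x) :
  g ∘ f = idm x -> Mono f.
Proof.
  intros e t a b E.
  now rewrite <- (comp_id_l a), <- (comp_id_l b), <- e, <- !comp_assoc, E.
Qed.

Lemma iso_mono {x y : C} (f : hom x y) : IsIso f -> Mono f.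
Proof. intros [g [gf _]]; exact (retract_mono gf). Qed.

Lemma mono_section {x y : C} (f : hom x y) (s : hom y x) :
  Mono f -> f ∘ s = idm y -> s ∘ f = idm x.
Proof.
  intros m e; apply m; now rewrite comp_assoc, e, comp_id_l, comp_id_r.
Qed.

Lemma iso_epi {x y z : C} (f : hom x y) (a b : hom y z) :
  IsIso f -> a ∘ f = b ∘ f -> a = b.
Proof.
  intros [g [_ fg]] e.
  now rewrite <- (comp_id_r a), <- (comp_id_r b), <- fg, !comp_assoc, e.
Qed.

Lemma pullback_swap {w x y z : C} (p : hom w x) (q : hom w y) (f : hom x z) (g : hom y z) :
  IsPullback p q f g -> IsPullback q p g f.
Proof.
  intros [c u]; split; [now symmetry|].
  intros t a b e; destruct (u t b a (eq_sym e)) as [h [[h1 h2] hu]].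
  exists h; split; [now split|].
  intros k [k1 k2]; now apply hu.
Qed.

Lemma pullback_cancel {x0 x1 x2 y0 y1 y2 : C}
    {p0 : hom x0 y0} {p1 : hom x1 y1} {p2 : hom x2 y2}
    {f : hom x0 x1} {f' : hom x1 x2} {g : hom y0 y1} {g' : hom y1 y2} :
  IsPullback f' p1 p2 g' -> IsPullback (f' ∘ f) p0 p2 (g' ∘ g) ->
  p1 ∘ f = g ∘ p0 -> IsPullback f p0 p1 g.
Proof.
  intros H' H e; split; [exact e|].
  intros t a b eab.
  assert (e2 : p2 ∘ (f' ∘ a) = g' ∘ g ∘ b).
  { now rewrite comp_assoc, (proj1 H'), <- comp_assoc, eab, comp_assoc. }
  destruct (proj2 H t _ b e2) as [h [[h1 h2] hu]].
  exists h; split.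
  - split; [|exact h2].
    apply (pullback_ext H').
    + now rewrite comp_assoc.
    + now rewrite comp_assoc, e, <- comp_assoc, h2.
  - intros k [k1 k2]; apply hu; split; [|exact k2].
    now rewrite <- comp_assoc, k1.
Qed.

(** Serves to carry pullbacks computed on representatives over to arbitrary arrows of the
    localization, whose domains become isomorphic there. *)
Lemma pullback_transport {w x y z w' x' y' : C}
    (p' : hom w' x') (q' : hom w' y') (f' : hom x' z) (g' : hom y' z)
    (p : hom w x) (q : hom w y) (f : hom x z) (g : hom y z)
    (k : hom w' w) (i : hom x' x) (j : hom y' y) :
  IsIso k -> IsIso i -> IsIso j ->
  p ∘ k = i ∘ p' -> q ∘ k = j ∘ q' -> f ∘ i = f' -> g ∘ j = g' ->
  IsPullback p' q' f' g' -> IsPullback p q f g.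
Proof.
  intros Hk [i' [i1 i2]] [j' [j1 j2]] ep eq ef eg H.
  assert (c : f ∘ p = g ∘ q).
  { apply (iso_epi Hk). rewrite <- !comp_assoc, ep, eq, !comp_assoc, ef, eg.
    exact (proj1 H). }
  split; [exact c|].
  intros t a b e.
  assert (e' : f' ∘ (i' ∘ a) = g' ∘ (j' ∘ b)).
  { now rewrite <- ef, <- eg, <- !comp_assoc, (comp_assoc i i'), i2,
      (comp_assoc j j'), j2, !comp_id_l. }
  destruct (proj2 H t _ _ e') as [h [[h1 h2] hu]].
  exists (k ∘ h); split.
  - split.
    + now rewrite comp_assoc, ep, <- comp_assoc, h1, comp_assoc, i2, comp_id_l.
    + now rewrite comp_assoc, eq, <- comp_assoc, h2, comp_assoc, j2, comp_id_l.
  - intros l [l1 l2].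
    destruct Hk as [k' [k1 k2]].
    rewrite (hu (k' ∘ l)).
    + now rewrite comp_assoc, k2, comp_id_l.
    + assert (ep' : p' ∘ k' = i' ∘ p).
      { rewrite <- (comp_id_l (p' ∘ k')), <- i1, <- !comp_assoc, (comp_assoc i), <- ep.
        now rewrite <- comp_assoc, k2, comp_id_r. }
      assert (eq' : q' ∘ k' = j' ∘ q).
      { rewrite <- (comp_id_l (q' ∘ k')), <- j1, <- !comp_assoc, (comp_assoc j), <- eq.
        now rewrite <- comp_assoc, k2, comp_id_r. }
      now rewrite !comp_assoc, ep', eq', <- !comp_assoc, l1, l2.
Qed.

Lemma pullback_unique {w w' x y z : C}
    (p : hom w x) (q : hom w y) (p' : hom w' x) (q' : hom w' y)
    (f : hom x z) (g : hom y z) :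
  IsPullback p q f g -> IsPullback p' q' f g ->
  exists k : hom w' w, IsIso k /\ p ∘ k = p' /\ q ∘ k = q'.
Proof.
  intros H H'.
  destruct (proj2 H _ p' q' (proj1 H')) as [k [[k1 k2] _]].
  destruct (proj2 H' _ p q (proj1 H)) as [l [[l1 l2] _]].
  exists k; split; [|now split].
  exists l; split.
  - apply (pullback_ext H'); rewrite comp_assoc, comp_id_r; congruence.
  - apply (pullback_ext H); rewrite comp_assoc, comp_id_r; congruence.
Qed.

Lemma kernel_diagonal {x y P : C} (f : hom x y) (p1 p2 : hom P x) :
  IsPullback p1 p2 f f -> exists dg : hom x P, p1 ∘ dg = idm x /\ p2 ∘ dg = idm x.
Proof.
  intros [_ u]; destruct (u x (idm x) (idm x) eq_refl) as [dg [H _]]; now exists dg.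
Qed.

(** Being mono is having a trivial kernel pair; with [pullback_mono] this makes it a property that
    any pullback-preserving functor keeps. *)
Lemma mono_pullback {x y : C} (f : hom x y) :
  Mono f -> IsPullback (idm x) (idm x) f f.
Proof.
  intros m; split; [reflexivity|].
  intros t a b e; exists a; split.
  - rewrite !comp_id_l; split; [reflexivity | now apply m].
  - intros k [k1 _]; now rewrite comp_id_l in k1.
Qed.

Lemma pullback_mono {x y : C} (f : hom x y) :
  IsPullback (idm x) (idm x) f f -> Mono f.
Proof.
  intros [_ u] t a b e; destruct (u t a b e) as [h [[h1 h2] _]]; congruence.
Qed.

Lemma mono_base_change {w x y z : C} (p : hom w x) (q : hom w y) (f : hom x z) (g : hom y z) :
  IsPullback p q f g -> Mono f -> Mono q.
Proof.
  intros H m t a b e; apply (pullback_ext H); [|exact e].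
  apply m; now rewrite !comp_assoc, (proj1 H), <- !comp_assoc, e.
Qed.

Lemma mono_comp {x y z : C} (g : hom y z) (f : hom x y) : Mono g -> Mono f -> Mono (g ∘ f).
Proof.
  intros Hg Hf t a b e; apply Hf, Hg; now rewrite !comp_assoc.
Qed.

End Pullbacks.

(** A mere existence statement, because pullbacks in the localization come from representatives that
    are not chosen. *)
Definition EnoughPullbacks (C : Category) : Prop :=
  forall (x y z : C) (f : hom x z) (g : hom y z),
    exists (w : C) (p : hom w x) (q : hom w y), IsPullback p q f g.

Definition Void {C : Category} (S : FiniteSums C) (x : C) : Prop :=
  inhabited (hom x (zero S)).

(** The pullback of [f] and [g] is initial, phrased on generalized elements so that no pullback has
    to be chosen. *)
Definition Apart {C : Category} (S : FiniteSums C) {x y z : C} (f : hom x z) (g : hom y z) :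
    Prop :=
  forall (t : C) (a : hom t x) (b : hom t y), f ∘ a = g ∘ b -> Void S t.

(** * Extensivity: case analysis on maps into a sum *)

Section Extensive.
Context {C : Category} (S : FiniteSums C) (St : StableSums S) (Dj : DisjointSums S)
  (PB : EnoughPullbacks C).

(* Pulling back [0 + 0 -> 0] along [x -> 0] makes the codiagonal of [x] invertible, so
   both coprojections [x -> x + x] agree. *)
Lemma void_ext {x t : C} (f g : hom x t) : Void S x -> f = g.
Proof.
  intros [z].
  pose proof (St (pullback_id_both z) (pullback_id_both z)) as H.
  assert (e : inl S x x = inr S x x).
  { apply (pullback_ext H).
    - unfold sum_map; rewrite copair_inl, copair_inr; f_equal.
      apply (exists_unique_eq (zero_initial S _)); trivial.
    - now rewrite copair_inl, copair_inr. }
  now rewrite <- (copair_inl S f g), e, copair_inr.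
Qed.

Lemma void_dom {x y : C} (f : hom x y) : Void S y -> Void S x.
Proof. intros [z]; constructor; exact (z ∘ f). Qed.

Lemma inl_neq_inr {a b t : C} (f : hom t a) (g : hom t b) :
  inl S a b ∘ f = inr S a b ∘ g -> Void S t.
Proof.
  intros e; destruct (Dj a b) as [_ [_ [_ u]]].
  destruct (u t f g e) as [h _]; now constructor.
Qed.

Lemma copair_inl_inr (a b : C) : copair S (inl S a b) (inr S a b) = idm (sum S a b).
Proof. apply sum_ext; now rewrite ?copair_inl, ?copair_inr, comp_id_l. Qed.

Lemma copair_comp {a b t s : C} (k : hom t s) (f : hom a t) (g : hom b t) :
  k ∘ copair S f g = copair S (k ∘ f) (k ∘ g).
Proof. apply sum_ext; now rewrite <- comp_assoc, ?copair_inl, ?copair_inr. Qed.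

Lemma sum_map_copair {a b a' b' t : C} (f : hom a' t) (g : hom b' t)
    (h : hom a a') (k : hom b b') :
  copair S f g ∘ sum_map S h k = copair S (f ∘ h) (g ∘ k).
Proof.
  unfold sum_map; now rewrite copair_comp, !comp_assoc, copair_inl, copair_inr.
Qed.

Lemma sum_map_inl {a b a' b' : C} (h : hom a a') (k : hom b b') :
  sum_map S h k ∘ inl S a b = inl S a' b' ∘ h.
Proof. apply copair_inl. Qed.

Lemma sum_map_inr {a b a' b' : C} (h : hom a a') (k : hom b b') :
  sum_map S h k ∘ inr S a b = inr S a' b' ∘ k.
Proof. apply copair_inr. Qed.

Lemma sum_map_iso {a b a' b' : C} (h : hom a a') (k : hom b b') :
  IsIso h -> IsIso k -> IsIso (sum_map S h k).
Proof.
  intros [h' [h1 h2]] [k' [k1 k2]]; exists (sum_map S h' k').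
  rewrite <- !sum_map_comp, h1, h2, k1, k2, !sum_map_id; now split.
Qed.

(** By stability the sum of the two pullbacks is a pullback of [idm (sum S a b)] along [f], hence a
    copy of [x]. *)
Lemma pulled_back_sum_iso {a b x x1 x2 : C} (f : hom x (sum S a b))
    (x1' : hom x1 x) (y1 : hom x1 a) (x2' : hom x2 x) (y2 : hom x2 b) :
  IsPullback y1 x1' (inl S a b) f -> IsPullback y2 x2' (inr S a b) f ->
  IsIso (copair S x1' x2').
Proof.
  intros H1 H2.
  pose proof (St H1 H2) as H; rewrite copair_inl_inr in H.
  destruct (pullback_unique H (pullback_id_both f)) as [k [Hk [_ k2]]].
  destruct Hk as [l [l1 l2]].
  replace (copair S x1' x2') with l; [exists k; now split|].
  now rewrite <- (comp_id_l l), <- k2, <- comp_assoc, l2, comp_id_r.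
Qed.

(** The case distinction on a generalized element of a sum: its domain splits into the parts landing
    in each summand. *)
Lemma sum_cover {a b x : C} (f : hom x (sum S a b)) :
  exists (x1 x2 : C) (i1 : hom x1 x) (i2 : hom x2 x) (y1 : hom x1 a) (y2 : hom x2 b),
    f ∘ i1 = inl S a b ∘ y1 /\ f ∘ i2 = inr S a b ∘ y2 /\ IsIso (copair S i1 i2).
Proof.
  destruct (PB (inl S a b) f) as [x1 [y1 [i1 H1]]].
  destruct (PB (inr S a b) f) as [x2 [y2 [i2 H2]]].
  exists x1, x2, i1, i2, y1, y2.
  split; [exact (eq_sym (proj1 H1))|]; split; [exact (eq_sym (proj1 H2))|].
  exact (pulled_back_sum_iso H1 H2).
Qed.

Lemma void_sum {x y : C} : Void S x -> Void S y -> Void S (sum S x y).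
Proof. intros [f] [g]; constructor; exact (copair S f g). Qed.

Lemma void_of_iso {x y : C} (k : hom x y) : IsIso k -> Void S x -> Void S y.
Proof. intros [l _] [f]; constructor; exact (f ∘ l). Qed.

Lemma copair_iso_ext {x1 x2 x t : C} (i1 : hom x1 x) (i2 : hom x2 x) (h k : hom x t) :
  IsIso (copair S i1 i2) -> h ∘ i1 = k ∘ i1 -> h ∘ i2 = k ∘ i2 -> h = k.
Proof.
  intros H e1 e2; apply (iso_epi H); now rewrite !copair_comp, e1, e2.
Qed.

Lemma factor_inl {a b x : C} (f : hom x (sum S a b)) :
  Apart S f (inr S a b) -> exists g : hom x a, inl S a b ∘ g = f.
Proof.
  intros H; destruct (sum_cover f) as (x1 & x2 & i1 & i2 & y1 & y2 & e1 & e2 & Hi).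
  assert (V : Void S x2) by exact (H _ _ _ e2).
  pose proof V as [z].
  pose proof Hi as [l [l1 _]].
  (* On the void part [x2] the value is irrelevant, so it is taken through the initial object. *)
  exists (copair S y1 (from_zero S a ∘ z) ∘ l).
  apply (copair_iso_ext Hi).
  - rewrite <- (copair_inl S i1 i2) at 1.
    rewrite <- !comp_assoc, (comp_assoc l), l1, comp_id_l, copair_inl.
    now symmetry.
  - now apply void_ext.
Qed.

(** Splitting both elements leaves four cases: the matching ones follow from [Mf] and [Mg], the
    mixed ones have void domain by apartness. *)
Lemma copair_mono {x y z : C} (f : hom x z) (g : hom y z) :
  Mono f -> Mono g -> Apart S f g -> Mono (copair S f g).
Proof.
  intros Mf Mg A t a b e.
  destruct (sum_cover a) as (x1 & x2 & i1 & i2 & y1 & y2 & e1 & e2 & Hi).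
  apply (copair_iso_ext Hi).
  - destruct (sum_cover (b ∘ i1)) as (u1 & u2 & j1 & j2 & v1 & v2 & d1 & d2 & Hj).
    assert (c : f ∘ y1 = copair S f g ∘ (b ∘ i1)).
    { now rewrite comp_assoc, <- e, <- comp_assoc, e1, comp_assoc, copair_inl. }
    apply (copair_iso_ext Hj).
    + rewrite d1, e1, <- comp_assoc; f_equal; apply Mf.
      now rewrite comp_assoc, c, <- comp_assoc, d1, comp_assoc, copair_inl.
    + apply void_ext, (A _ (y1 ∘ j2) v2).
      now rewrite comp_assoc, c, <- comp_assoc, d2, comp_assoc, copair_inr.
  - destruct (sum_cover (b ∘ i2)) as (u1 & u2 & j1 & j2 & v1 & v2 & d1 & d2 & Hj).
    assert (c : g ∘ y2 = copair S f g ∘ (b ∘ i2)).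
    { now rewrite comp_assoc, <- e, <- comp_assoc, e2, comp_assoc, copair_inr. }
    apply (copair_iso_ext Hj).
    + apply void_ext, (A _ v1 (y2 ∘ j1)).
      now rewrite comp_assoc, c, <- (comp_assoc _ _ j1), d1, comp_assoc, copair_inl.
    + rewrite d2, e2, <- comp_assoc; f_equal; apply Mg.
      now rewrite comp_assoc, c, <- comp_assoc, d2, comp_assoc, copair_inr.
Qed.

End Extensive.

(** * Derivatives as universal points *)

Section Derivative.
Context {C : Category} (S : FiniteSums C) (St : StableSums S) (Dj : DisjointSums S)
  (PB : EnoughPullbacks C).

Notation codiag d := (copair S (ar_arr d) (idm (ar_cod d))).

Definition point {p d : Poly11 C} (u : hom (star1 S St d) p) : hom (ar_cod d) (ar_dom p) :=
  sq_dom u ∘ inr S (ar_dom d) (ar_cod d).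

Lemma arr_point {p d : Poly11 C} (u : hom (star1 S St d) p) :
  ar_arr p ∘ point u = sq_cod u.
Proof.
  unfold point; rewrite comp_assoc, (proj1 (sq_pb u)); simpl.
  now rewrite <- comp_assoc, copair_inr, comp_id_r.
Qed.

Lemma point_comp {p d q : Poly11 C} (u : hom (star1 S St d) p) (m : hom q d) :
  point (u ∘ fmap (star1 S St) m) = point u ∘ sq_cod m.
Proof.
  unfold point; simpl; now rewrite <- !comp_assoc, sum_map_inr.
Qed.

(** Both sums are pullbacks of [p], which gives a map [k] between them over [h]. Agreement of the
    points makes [k] respect the right summands; it then respects their complements, and its left
    part is the required square. *)
Lemma lift_of_point {p d q : Poly11 C} (u : hom (star1 S St d) p)
    (v : hom (star1 S St q) p) (h : hom (ar_cod q) (ar_cod d)) :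
  point u ∘ h = point v ->
  exists m : hom q d, sq_cod m = h /\ u ∘ fmap (star1 S St) m = v.
Proof.
  intros e.
  pose proof (sq_pb u) as Hu; simpl in Hu.
  assert (eh : sq_cod u ∘ h = sq_cod v).
  { now rewrite <- !arr_point, <- comp_assoc, e. }
  assert (Hv : IsPullback (sq_dom v) (codiag q) (ar_arr p) (sq_cod u ∘ h)).
  { rewrite eh; exact (sq_pb v). }
  destruct (proj2 Hu (sum S (ar_dom q) (ar_cod q)) (sq_dom v) (h ∘ codiag q)) as [k [[k1 k2] _]].
  { rewrite comp_assoc; exact (proj1 Hv). }
  assert (Hk : IsPullback k (codiag q) (codiag d) h).
  { apply (pullback_cancel Hu); [|exact k2].
    rewrite k1; exact Hv. }
  assert (kr : k ∘ inr S _ _ = inr S _ _ ∘ h).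
  { apply (pullback_ext Hu).
    - rewrite comp_assoc, k1; rewrite comp_assoc; now symmetry.
    - now rewrite comp_assoc, k2, <- comp_assoc, copair_inr, comp_assoc, copair_inr,
        comp_id_l, comp_id_r. }
  (* A left element sent by [k] to the right would equal the right element over the same base, since
     [Hk] separates elements; disjointness makes its stage void. *)
  destruct (factor_inl St PB (f := k ∘ inl S _ _)) as [f ef].
  { intros w a b c.
    assert (eb : b = h ∘ (ar_arr q ∘ a)).
    { rewrite <- (comp_id_l b), <- (copair_inr S (ar_arr d) (idm (ar_cod d))),
        <- comp_assoc, <- c, !comp_assoc, k2, <- (comp_assoc h _ (inl S _ _)).
      now rewrite copair_inl. }
    apply (inl_neq_inr Dj (f := a) (g := ar_arr q ∘ a)).
    apply (pullback_ext Hk).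
    - now rewrite comp_assoc, c, eb, !comp_assoc, kr.
    - now rewrite !comp_assoc, copair_inl, copair_inr, comp_id_l. }
  assert (ek : sum_map S f h = k).
  { apply sum_ext; now rewrite ?sum_map_inl, ?sum_map_inr. }
  assert (Hf : IsPullback f (ar_arr q) (ar_arr d) h).
  { split.
    - rewrite <- (copair_inl S (ar_arr d) (idm (ar_cod d))), <- comp_assoc, ef,
        comp_assoc, k2, <- comp_assoc; now rewrite copair_inl.
    - intros t a b c.
      destruct (proj2 Hk t (inl S _ _ ∘ a) b) as [x [[x1 x2] _]].
      { now rewrite comp_assoc, copair_inl. }
      (* Where [x] is on the right, so is its image under [k], but that image is the left element
         [a]. *)
      destruct (factor_inl St PB (f := x)) as [y ey].
      { intros w a' b' c'.
        apply (inl_neq_inr Dj (f := a ∘ a') (g := h ∘ b')).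
        now rewrite !comp_assoc, <- x1, <- kr, <- !comp_assoc, c'. }
      assert (My : Mono (inl S (ar_dom d) (ar_cod d))) by exact (proj1 (Dj _ _)).
      exists y; split.
      + split.
        * apply My; now rewrite comp_assoc, ef, <- comp_assoc, ey.
        * now rewrite <- x2, <- ey, comp_assoc, copair_inl.
      + intros y' [y1 y2].
        apply (proj1 (Dj (ar_dom q) (ar_cod q))); rewrite ey.
        apply (pullback_ext Hk).
        * now rewrite x1, comp_assoc, <- ef, <- comp_assoc, y1.
        * now rewrite x2, comp_assoc, copair_inl. }
  exists (mkSquare Hf : hom q d); split; [reflexivity|].
  apply square_eq; simpl; [|exact eh].
  now rewrite ek.
Qed.

Lemma lift_unique {p d q : Poly11 C} (u : hom (star1 S St d) p) (m m' : hom q d) :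
  sq_cod m = sq_cod m' ->
  u ∘ fmap (star1 S St) m = u ∘ fmap (star1 S St) m' -> m = m'.
Proof.
  intros ec e; apply square_eq; [|exact ec].
  apply (proj1 (Dj (ar_dom d) (ar_cod d))).
  apply (pullback_ext (sq_pb u)); simpl.
  - apply (f_equal (@sq_dom _ _ _)) in e; simpl in e.
    apply (f_equal (fun x => x ∘ inl S _ _)) in e.
    now rewrite <- !comp_assoc, !sum_map_inl in e.
  - now rewrite !comp_assoc, !copair_inl, (proj1 (sq_pb m)), (proj1 (sq_pb m')), ec.
Qed.

(** Every point factors uniquely through an invertible one, and [lift_of_point] turns that
    factorization into a map of polynomials. *)
Lemma derivative_of_iso_point {p d : Poly11 C} (u : hom (star1 S St d) p) :
  IsIso (point u) -> IsDerivative St p d u.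
Proof.
  intros Hi q v; pose proof Hi as [i [_ i2]].
  destruct (@lift_of_point p d q u v (i ∘ point v)) as [m [_ m2]].
  { now rewrite comp_assoc, i2, comp_id_l. }
  exists m; split; [exact m2|].
  intros m' e; apply (lift_unique (u := u)); [|congruence].
  apply (iso_mono Hi); rewrite <- !point_comp; congruence.
Qed.

(** Here [N] is the negation of the diagonal, given by its universal property. A pullback around
    [copair S n dg] and [p2] with base map [r'] is the same thing as a square [q * 1 -> p] with
    point [r']: the preimage of [dg] is the section and the preimage of [n] its complement. *)
Lemma derivative_distributivity {p d : Poly11 C} (u : hom (star1 S St d) p)
    {P N : C} (p1 p2 : hom P (ar_dom p)) (dg : hom (ar_dom p) P) (n : hom N P) :
  IsPullback p1 p2 (ar_arr p) (ar_arr p) ->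
  p1 ∘ dg = idm _ -> p2 ∘ dg = idm _ ->
  Mono n -> Apart S n dg ->
  (forall (t : C) (x : hom t P), Apart S x dg -> exists y, n ∘ y = x) ->
  IsDerivative St p d u ->
  exists i : hom (sum S (ar_dom d) (ar_cod d)) (sum S N (ar_dom p)),
    IsDistributivityPullback (copair S n dg) p2 i (codiag d) (point u).
Proof.
  intros HP d1 d2 Mn An Un Du.
  set (ud := sq_dom u : hom (sum S (ar_dom d) (ar_cod d)) (ar_dom p)).
  assert (Hu : IsPullback ud (codiag d) (ar_arr p) (sq_cod u)) by exact (sq_pb u).
  assert (Mdg : Mono dg) by exact (retract_mono d1).
  assert (Mm : Mono (copair S n dg)) by now apply copair_mono.
  (* [T] pairs an element of a fibre with the point of that fibre, so the right summand goes to the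
     diagonal. *)
  destruct (proj2 HP _ ud (point u ∘ codiag d)) as [T [[T1 T2] _]].
  { now rewrite comp_assoc, arr_point, (proj1 Hu). }
  assert (HT : IsPullback T (codiag d) p2 (point u)).
  { apply (pullback_cancel HP); [|exact T2].
    now rewrite T1, arr_point. }
  assert (Tr : T ∘ inr S _ _ = dg ∘ point u).
  { apply (pullback_ext HP).
    - now rewrite !comp_assoc, T1, d1, comp_id_l.
    - now rewrite !comp_assoc, T2, d2, comp_id_l, <- comp_assoc, copair_inr, comp_id_r. }
  (* The left summand misses the diagonal, so [T] sends it into the negation. *)
  destruct (Un _ (T ∘ inl S _ _)) as [nF enF].
  { intros t w b e.
    assert (eb : b = point u ∘ (ar_arr d ∘ w)).
    { rewrite <- (comp_id_l b), <- d2, <- comp_assoc, <- e, !comp_assoc, T2,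
        <- (comp_assoc (point u) _ (inl S _ _)); now rewrite copair_inl. }
    apply (inl_neq_inr Dj (f := w) (g := ar_arr d ∘ w)).
    apply (pullback_ext HT).
    - now rewrite comp_assoc, e, eb, !comp_assoc, Tr.
    - now rewrite !comp_assoc, copair_inl, copair_inr, comp_id_l. }
  exists (sum_map S nF (point u)).
  assert (mi : copair S n dg ∘ sum_map S nF (point u) = T).
  { rewrite sum_map_copair; apply sum_ext; rewrite ?copair_inl, ?copair_inr; congruence. }
  split; [now rewrite mi|].
  intros z' y' i' q' r' H'.
  (* The section of [q'] given by the diagonal pair [(r', r')]; by [Hs] below it is exactly the part
     of [z'] over the right summand. *)
  destruct (proj2 H' _ (dg ∘ r') (idm y')) as [s [[s1 s2] _]].
  { now rewrite comp_assoc, d2, comp_id_l, comp_id_r. }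
  assert (is' : i' ∘ s = inr S _ _ ∘ r').
  { apply Mm; now rewrite comp_assoc, s1, comp_assoc, copair_inr. }
  assert (Hs : IsPullback r' s (inr S N (ar_dom p)) i').
  { split; [now symmetry|].
    intros t a x e; exists (q' ∘ x).
    assert (ra : r' ∘ (q' ∘ x) = a).
    { rewrite comp_assoc, <- (proj1 H'), <- !comp_assoc, <- e, (comp_assoc _ _ a),
        copair_inr, comp_assoc, d2; apply comp_id_l. }
    split.
    - split; [exact ra|].
      apply (pullback_ext H').
      + rewrite comp_assoc, s1, <- !comp_assoc, ra, <- e, comp_assoc, copair_inr.
        reflexivity.
      + now rewrite comp_assoc, s2, comp_id_l.
    - intros k [_ k2]; now rewrite <- k2, comp_assoc, s2, comp_id_l. }
  (* [G] is the complement of [s], so [q' ∘ j] is a polynomial [q] whose [q * 1] is isomorphic to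
     [q'] via [c]. *)
  destruct (PB (inl S N (ar_dom p)) i') as [G [g [j HG]]].
  pose proof (pulled_back_sum_iso St HG Hs) as Hc.
  set (c := copair S j s) in Hc.
  pose (q := mkArr (q' ∘ j) : Poly11 C).
  assert (qc : q' ∘ c = copair S (q' ∘ j) (idm y')).
  { unfold c; now rewrite copair_comp, s2. }
  assert (Hv : IsPullback (p1 ∘ (copair S n dg ∘ i') ∘ c) (copair S (q' ∘ j) (idm y'))
                 (ar_arr p) (ar_arr p ∘ r')).
  { rewrite <- qc; apply pullback_iso; [exact Hc|].
    now apply (pullback_paste HP). }
  pose (v := mkSquare (p := star1 S St q) (q := p) Hv : hom (star1 S St q) p).
  assert (pv : point v = r').
  { unfold point; simpl; unfold c.
    rewrite <- !comp_assoc, copair_inr, is', (comp_assoc _ (inr S _ _)), copair_inr,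
      comp_assoc, d1; apply comp_id_l. }
  destruct (Du q v) as [h [eh uh]].
  pose proof Hc as [c' [c1 c2]].
  assert (ph : point u ∘ sq_cod h = r').
  { rewrite <- point_comp, eh; exact pv. }
  pose (hs := sum_map S (sq_dom h) (sq_cod h) :
    hom (sum S G y') (sum S (ar_dom d) (ar_cod d))).
  assert (edom : ud ∘ hs = p1 ∘ (copair S n dg ∘ i') ∘ c).
  { exact (f_equal (@sq_dom _ _ _) eh). }
  assert (ecod : codiag d ∘ hs = sq_cod h ∘ (q' ∘ c)).
  { unfold hs; rewrite qc, sum_map_copair, copair_comp, comp_id_l, comp_id_r.
    now rewrite (proj1 (sq_pb h)). }
  exists (hs ∘ c', sq_cod h).
  assert (e2 : codiag d ∘ (hs ∘ c') = sq_cod h ∘ q').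
  { now rewrite comp_assoc, ecod, <- !comp_assoc, c2, comp_id_r. }
  split.
  - simpl; split; [|split; [exact e2 | exact ph]].
    apply Mm; rewrite (comp_assoc _ (sum_map S nF (point u))), mi.
    apply (pullback_ext HP).
    + rewrite (comp_assoc p1 T), T1, (comp_assoc ud), edom, <- comp_assoc, c2.
      apply comp_id_r.
    + rewrite (comp_assoc p2 T), T2, <- comp_assoc, e2, comp_assoc, ph.
      now rewrite (proj1 H').
  - intros [k1 k2]; simpl; intros [a1 [a2 a3]].
    (* A competing base map [k2] lifts to a map of polynomials, to which uniqueness in [Du]
       applies. *)
    destruct (@lift_of_point p d q u v k2) as [m [m1 m2]]; [now rewrite pv|].
    assert (ek : sq_cod h = k2) by (rewrite <- m1; f_equal; now apply uh).
    f_equal; [|exact ek].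
    apply (pullback_ext HT).
    + rewrite <- mi, <- !(comp_assoc (copair S n dg)), a1.
      apply (pullback_ext HP).
      * rewrite (comp_assoc (copair S n dg)), mi, (comp_assoc p1 T), T1, (comp_assoc ud), edom,
          <- comp_assoc, c2; apply comp_id_r.
      * rewrite (comp_assoc (copair S n dg)), mi, (comp_assoc p2 T), T2, <- comp_assoc, e2,
          comp_assoc, ph; now rewrite (proj1 H').
    + rewrite e2, a2; now f_equal.
Qed.

Lemma iso_of_distributivity {x e b z y : C}
    (g : hom x e) (p : hom e b) (i : hom z x) (q : hom z y) (r : hom y b) :
  IsIso g -> IsDistributivityPullback g p i q r -> IsIso r.
Proof.
  intros [g' [g1 g2]] [H U].
  (* With [g] invertible, [p] over the identity of [b] is itself a competing diagram; it yields a
     section [h2] of [r], and terminality makes [h2 ∘ r] the identity. *)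
  destruct (U e b g' p (idm b)) as [[h1 h2] [[e1 [e2 e3]] _]].
  { rewrite g2; apply pullback_swap, pullback_id_both. }
  simpl in e1, e2, e3.
  exists h2; split; [|exact e3].
  pose proof (U z y i q r H) as Ui.
  change (snd (h1 ∘ (g ∘ i), h2 ∘ r) = snd (idm z, idm y)); f_equal.
  apply (exists_unique_eq Ui); simpl.
  - repeat split.
    + now rewrite comp_assoc, e1, comp_assoc, g1, comp_id_l.
    + now rewrite comp_assoc, e2, <- !comp_assoc, (proj1 H), !comp_assoc.
    + now rewrite comp_assoc, e3, comp_id_l.
  - now rewrite !comp_id_l, !comp_id_r.
Qed.

End Derivative.

(** * Negation and dense monomorphisms *)

Section Negation.
Context {C : Category} (L : LocallyCartesianClosed C) (S : FiniteSums C)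
  (St : StableSums S).

Lemma lcc_enough_pullbacks : EnoughPullbacks C.
Proof.
  intros x y z f g; destruct (lcc_pb L f g) as [w p q H]; now exists w, p, q.
Qed.

(** The counit of [Pi] sends the pullback of the negation along [q] to the initial object. *)
Lemma apart_neg {x y : C} (q : hom x y) : Apart S (sl_arr (neg L S q)) q.
Proof.
  intros t a b e.
  destruct (proj2 (pb_is (lcc_pb L (sl_arr (neg L S q)) q)) t a b e) as [h _].
  pose proof (proj1_sig (ua_arr (lcc_pi L q (mkSlice (from_zero S x))))) as k.
  constructor; exact (k ∘ h).
Qed.

(** Apartness makes the pullback of [f] along [q] void, hence a map into [0 -> x] in the slice, and
    the adjunction transposes it. *)
Lemma neg_factor {x y t : C} (q : hom x y) (f : hom t y) :
  Apart S f q -> exists h : hom t (sl_dom (neg L S q)), sl_arr (neg L S q) ∘ h = f.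
Proof.
  intros A; set (P := lcc_pb L f q).
  assert (V : Void S (pb_ob P)) by exact (A _ _ _ (proj1 (pb_is P))).
  pose proof V as [z].
  assert (e : from_zero S x ∘ z = pb_snd P) by now apply (void_ext St).
  destruct (ua_univ (lcc_pi L q (mkSlice (from_zero S x))) (q := mkSlice f)
    (exist _ z e)) as [h _].
  exists (proj1_sig h); exact (proj2_sig h).
Qed.

Lemma neg_mono {x y : C} (q : hom x y) : Mono (sl_arr (neg L S q)).
Proof.
  intros t a b e.
  set (T := mkSlice (sl_arr (neg L S q) ∘ a) : Slice y).
  pose (a' := exist _ a eq_refl : hom T (neg L S q)).
  pose (b' := exist _ b (eq_sym e) : hom T (neg L S q)).
  assert (ab : a' = b'); [|exact (f_equal (@proj1_sig _ _) ab)].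
  set (u := ua_arr (lcc_pi L q (mkSlice (from_zero S x)))).
  refine (exists_unique_eq (ua_univ (lcc_pi L q (mkSlice (from_zero S x)))
    (q := T) (u ∘ fmap (delta (@lcc_pb C L) q) b')) _ eq_refl).
  apply sig_eq, (void_ext St).
  constructor; exact (proj1_sig (u ∘ fmap (delta (@lcc_pb C L) q) a')).
Qed.

Lemma dense_iff {x y : C} (q : hom x y) :
  Dense L S q <-> forall (t : C) (f : hom t y), Apart S f q -> Void S t.
Proof.
  set (n := neg L S q).
  (* The double negation is all of [y] exactly when [idm y] is apart from [n]. The isomorphism is
     then automatic, the double negation being a monomorphism with a section. *)
  assert (H : Dense L S q <-> Void S (sl_dom n)).
  { split.
    - intros [_ [[l el] _]]; simpl in l, el.
      apply (@apart_neg (sl_dom n) y (sl_arr n) _ (l ∘ sl_arr n) (idm _)).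
      exact (eq_trans (comp_assoc _ _ _)
        (eq_trans (f_equal (fun k => k ∘ sl_arr n) el)
          (eq_trans (comp_id_l _) (eq_sym (comp_id_r _))))).
    - intros V.
      destruct (@neg_factor (sl_dom n) y y (sl_arr n) (idm y)) as [h eh].
      { intros t a b _; exact (void_dom b V). }
      set (N := neg L S (sl_arr n)) in *.
      pose (k := exist _ (sl_arr N) (comp_id_l (sl_arr N)) :
        hom N (mkSlice (idm y) : Slice y)).
      pose (l := exist _ h eh : hom (mkSlice (idm y) : Slice y) N).
      exists k, l; split; apply sig_eq; simpl; [|exact eh].
      exact (mono_section (neg_mono (q := sl_arr n)) eh). }
  rewrite H; split.
  - intros V t f A; destruct (neg_factor A) as [h _]; exact (void_dom h V).
  - intros D; exact (D _ _ (apart_neg (q := q))).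
Qed.

End Negation.

(* The properties of the class of dense monomorphisms that make its localization
   computable by partial maps. *)
Record DomainClass {C : Category} (W : MorphismClass C) : Prop := {
  dc_mono : forall (x y : C) (w : hom x y), W x y w -> Mono w;
  dc_id : forall x : C, W x x (idm x);
  dc_comp : forall (x y z : C) (v : hom y z) (w : hom x y),
    W y z v -> W x y w -> W x z (v ∘ w);
  dc_pullback : forall (w x y z : C) (p : hom w x) (q : hom w y)
      (f : hom x z) (g : hom y z),
    IsPullback p q f g -> W x z f -> W w y q }.

Section DenseMono.
Context {C : Category} (L : LocallyCartesianClosed C) (S : FiniteSums C)
  (Dj : DisjointSums S).
Let St := lcc_stable_sums L S.

Lemma dense_mono_class : DomainClass (DenseMono L S).
Proof.
  split.
  - now intros x y w [m _].
  - intros x; split; [intros t a b; now rewrite !comp_id_l|].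
    apply (dense_iff L St); intros t f A; apply (A t (idm t) f).
    now rewrite comp_id_l, comp_id_r.
  - intros x y z v w [mv dv] [mw dw]; split; [now apply mono_comp|].
    apply (dense_iff L St); intros t f A.
    apply (proj1 (dense_iff L St v) dv t f); intros s a b e.
    apply (proj1 (dense_iff L St w) dw s b); intros r c d e'.
    apply (A r (a ∘ c) d); now rewrite comp_assoc, e, <- !comp_assoc, e'.
  - intros w x y z p q f g H [mf df]; split; [exact (mono_base_change H mf)|].
    apply (dense_iff L St); intros t h A.
    apply (proj1 (dense_iff L St f) df t (g ∘ h)); intros s a b e.
    destruct (proj2 H s b (h ∘ a)) as [k [[_ k2] _]].
    { now rewrite comp_assoc, e. }
    apply (A s a k); now symmetry.
Qed.

Lemma dense_mono_sum_map {a b a' b' : C} (v : hom a a') (w : hom b b') :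
  DenseMono L S v -> DenseMono L S w -> DenseMono L S (sum_map S v w).
Proof.
  intros [mv dv] [mw dw]; pose proof (lcc_enough_pullbacks L) as PB; split.
  - destruct (Dj a' b') as [ml [mr _]].
    apply (copair_mono St PB); [now apply mono_comp | now apply mono_comp |].
    intros t f g e; apply (inl_neq_inr Dj (f := v ∘ f) (g := w ∘ g)).
    now rewrite !comp_assoc.
  - apply (dense_iff L St); intros t f A.
    destruct (sum_cover St PB f) as (x1 & x2 & i1 & i2 & y1 & y2 & e1 & e2 & Hi).
    apply (void_of_iso Hi), void_sum.
    + apply (proj1 (dense_iff L St v) dv x1 y1); intros s c d e.
      apply (A s (i1 ∘ c) (inl S a b ∘ d)).
      now rewrite !comp_assoc, e1, sum_map_inl, <- !comp_assoc, e.
    + apply (proj1 (dense_iff L St w) dw x2 y2); intros s c d e.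
      apply (A s (i2 ∘ c) (inr S a b ∘ d)).
      now rewrite !comp_assoc, e2, sum_map_inr, <- !comp_assoc, e.
Qed.

(** Excluded middle up to density: what is apart from [q] lies in its negation, so what is apart
    from both is apart from itself. *)
Lemma dense_mono_neg_sum {x y : C} (q : hom x y) :
  Mono q -> DenseMono L S (copair S (sl_arr (neg L S q)) q).
Proof.
  intros mq; split.
  - apply (copair_mono St (lcc_enough_pullbacks L)); [now apply neg_mono | exact mq |].
    apply apart_neg.
  - apply (dense_iff L St); intros t f A.
    destruct (neg_factor L St (q := q) (f := f)) as [h eh].
    { intros s a b e; apply (A s a (inr S _ _ ∘ b)).
      now rewrite comp_assoc, copair_inr. }
    apply (A t (idm t) (inl S _ _ ∘ h)).
    now rewrite comp_assoc, copair_inl, comp_id_r, eh.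
Qed.

End DenseMono.

(** * Localization by partial maps *)

Section PartialMaps.
Context {C : Category} (W : MorphismClass C) (DW : DomainClass W)
  (PB : EnoughPullbacks C).

Notation L := (Localization W).

(** Retyped so that composites are taken in the localization; [emb] does the same for
    [fmap (loc W)]. *)
Definition class {x y : C} (a : Zig W x y) : @hom L x y := zclass a.

Lemma class_comp {x y z : C} (b : Zig W y z) (a : Zig W x y) :
  class b ∘ class a = class (zcomp b a).
Proof. apply loc_comp_zclass. Qed.

Definition emb {x y : C} (f : hom x y) : @hom L x y := class (zmap W f).

Lemma emb_comp {x y z : C} (g : hom y z) (f : hom x y) : emb (g ∘ f) = emb g ∘ emb f.
Proof. exact (fmap_comp (loc W) g f). Qed.

Lemma emb_iso {x y : C} (w : hom x y) : W w -> IsIso (emb w).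
Proof. exact (@loc_inverts C W x y w). Qed.

(* A zigzag, read as the graph of a partial map on generalized elements. *)
Fixpoint graph {x y : C} (a : Zig W x y) : forall t : C, hom t x -> hom t y -> Prop :=
  match a in Zig _ x y return forall t : C, hom t x -> hom t y -> Prop with
  | zmap _ f => fun t g h => f ∘ g = h
  | @zinv _ _ _ _ w _ => fun t g h => w ∘ h = g
  | zcomp b a => fun t g h => exists m, graph a g m /\ graph b m h
  end.

Lemma graph_fun {x y : C} (a : Zig W x y) {t : C} (g : hom t x) (h k : hom t y) :
  graph a g h -> graph a g k -> h = k.
Proof.
  revert t g h k; induction a as [x y f|x y w Hw|x y z b IHb a IHa]; simpl; intros t g h k.
  - congruence.
  - intros e1 e2; apply (dc_mono DW Hw); congruence.
  - intros [m [m1 m2]] [n [n1 n2]].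
    rewrite (IHa _ _ _ _ n1 m1) in n2; exact (IHb _ _ _ _ m2 n2).
Qed.

Lemma graph_restrict {x y : C} (a : Zig W x y) {t s : C} (g : hom t x) (h : hom t y)
    (r : hom s t) :
  graph a g h -> graph a (g ∘ r) (h ∘ r).
Proof.
  revert t g h r; induction a as [x y f|x y w Hw|x y z b IHb a IHa]; simpl; intros t g h r.
  - intros e; now rewrite comp_assoc, e.
  - intros e; now rewrite comp_assoc, e.
  - intros [m [m1 m2]]; exists (m ∘ r); auto.
Qed.

(** A formal inverse of [w] is defined on the pullback of [w] along [g], whose inclusion is again in
    [W]. *)
Lemma graph_total {x y : C} (a : Zig W x y) {t : C} (g : hom t x) :
  exists (s : C) (v : hom s t) (h : hom s y), W v /\ graph a (g ∘ v) h.
Proof.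
  revert t g; induction a as [x y f|x y w Hw|x y z b IHb a IHa]; simpl; intros t g.
  - exists t, (idm t), (f ∘ g); split; [apply (dc_id DW)|now rewrite comp_id_r].
  - destruct (PB w g) as [s [h [v H]]].
    exists s, v, h; split; [exact (dc_pullback DW H Hw)|exact (proj1 H)].
  - destruct (IHa t g) as (s & v & m & Hv & Hm).
    destruct (IHb s m) as (r & u & h & Hu & Hh).
    exists r, (v ∘ u), h; split; [now apply (dc_comp DW)|].
    exists (m ∘ u); split; [|exact Hh].
    rewrite comp_assoc; now apply graph_restrict.
Qed.

Lemma graph_emb {x y : C} (a : Zig W x y) {t : C} (g : hom t x) (h : hom t y) :
  graph a g h -> class a ∘ emb g = emb h.
Proof.
  revert t g h; induction a as [x y f|x y w Hw|x y z b IHb a IHa]; intros t g h G; simpl in G.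
  - subst; symmetry; apply emb_comp.
  - subst; rewrite emb_comp, comp_assoc.
    assert (e : class (zinv Hw) ∘ emb w = idm (x : L)).
    { exact (eq_trans (class_comp _ _) (zclass_eq (ze_inv_l Hw))). }
    rewrite e; apply comp_id_l.
  - destruct G as [m [m1 m2]].
    now rewrite <- (IHb _ _ _ m2), <- (IHa _ _ _ m1), <- class_comp, comp_assoc.
Qed.

(** The invariant that separates zigzags: each generating relation is an inclusion of graphs, and
    totality turns an inclusion into agreement on a domain in [W]. *)
Lemma graph_agree {x y : C} (a b : Zig W x y) :
  ZigEq a b -> forall (t : C) (g : hom t x),
  exists (s : C) (v : hom s t) (h : hom s y),
    W v /\ graph a (g ∘ v) h /\ graph b (g ∘ v) h.
Proof.
  assert (from_total : forall (x y : C) (a b : Zig W x y),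
    (forall (t : C) (g : hom t x) (h : hom t y), graph a g h -> graph b g h) ->
    forall (t : C) (g : hom t x), exists (s : C) (v : hom s t) (h : hom s y),
      W v /\ graph a (g ∘ v) h /\ graph b (g ∘ v) h).
  { intros x' y' a' b' H t g; destruct (graph_total a' g) as (s & v & h & Hv & Hh).
    exists s, v, h; auto. }
  intros E; induction E as
    [x y a|x y a b _ IH|x y a b c _ IH1 _ IH2|x y z a a' b b' _ IHa _ IHb
    |x y z t c b a|x y a|x y a|x y z g f|x y w Hw|x y w Hw].
  - apply from_total; auto.
  - intros t g; destruct (IH t g) as (s & v & h & H1 & H2 & H3).
    exists s, v, h; auto.
  - intros t g; destruct (IH1 t g) as (s & v & h & H1 & H2 & H3).
    destruct (IH2 s (g ∘ v)) as (r & u & k & K1 & K2 & K3).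
    exists r, (v ∘ u), k; rewrite comp_assoc; repeat split;
      [now apply (dc_comp DW)| |exact K3].
    (* The middle zigzag has one value on the common domain, so the outer two agree there. *)
    rewrite <- (graph_fun (graph_restrict u H3) K2); now apply graph_restrict.
  - intros t g; destruct (IHb t g) as (s & v & m & H1 & H2 & H3).
    destruct (IHa s m) as (r & u & k & K1 & K2 & K3).
    exists r, (v ∘ u), k; rewrite comp_assoc; split; [now apply (dc_comp DW)|].
    split; exists (m ∘ u); split; auto using graph_restrict.
  - apply from_total; simpl; intros s g h [m [[n [n1 n2]] m2]]; eauto.
  - apply from_total; simpl; intros s g h [m [m1 m2]].
    rewrite comp_id_l in m2; now subst m.
  - apply from_total; simpl; intros s g h [m [m1 m2]].
    rewrite comp_id_l in m1; now subst m.
  - apply from_total; simpl; intros s k h [m [m1 m2]]; subst.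
    now rewrite comp_assoc.
  - apply from_total; simpl; intros s k h [m [m1 m2]]; subst.
    rewrite comp_id_l; apply (dc_mono DW Hw); congruence.
  - apply from_total; simpl; intros s k h [m [m1 m2]]; subst.
    apply comp_id_l.
Qed.

Lemma emb_eq {x y : C} (f g : hom x y) :
  emb f = emb g -> exists (t : C) (w : hom t x), W w /\ f ∘ w = g ∘ w.
Proof.
  intros e.
  assert (E : ZigEq (zmap W f) (zmap W g)).
  { apply (f_equal (@proj1_sig _ _)) in e; simpl in e; rewrite e; apply ze_refl. }
  destruct (graph_agree E (idm x)) as (s & v & h & H1 & H2 & H3); simpl in H2, H3.
  exists s, v; rewrite comp_id_l in *; split; congruence.
Qed.

Lemma domain_of {x y : C} (P : @hom L x y) :
  exists (t : C) (w : hom t x) (g : hom t y), W w /\ P ∘ emb w = emb g.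
Proof.
  destruct (zclass_surj P) as [a ->].
  destruct (graph_total a (idm x)) as (t & w & g & Hw & Hg); rewrite comp_id_l in Hg.
  exists t, w, g; split; [exact Hw | exact (graph_emb Hg)].
Qed.

Lemma common_domain {x y z : C} (P : @hom L x y) (R : @hom L x z) :
  exists (t : C) (w : hom t x) (g : hom t y) (h : hom t z),
    W w /\ P ∘ emb w = emb g /\ R ∘ emb w = emb h.
Proof.
  destruct (domain_of P) as (t & w & g & Hw & Hg).
  destruct (domain_of (R ∘ emb w : @hom L t z)) as (s & v & h & Hv & Hh).
  exists s, (w ∘ v), (g ∘ v), h; split; [now apply (dc_comp DW)|].
  now rewrite !emb_comp, !comp_assoc, Hg.
Qed.

Lemma emb_epi {t x y : C} (w : hom t x) (P R : @hom L x y) :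
  W w -> P ∘ emb w = R ∘ emb w -> P = R.
Proof. intros Hw; apply iso_epi, emb_iso, Hw. Qed.

Lemma emb_terminal (o : C) : IsTerminal o -> @IsTerminal L o.
Proof.
  intros T x; destruct (T x) as [f _].
  exists (emb f); split; [trivial|]; intros R _.
  destruct (domain_of R) as (t & w & g & Hw & e).
  apply (emb_epi Hw); rewrite e, <- emb_comp; f_equal.
  apply (exists_unique_eq (T t)); trivial.
Qed.

(** A cone in the localization is represented on a domain where it commutes already in [C]; the
    mediating map exists there, and the domain is inverted. *)
Lemma emb_pullback {w x y z : C} (p : hom w x) (q : hom w y) (f : hom x z) (g : hom y z) :
  IsPullback p q f g -> IsPullback (emb p) (emb q) (emb f) (emb g).
Proof.
  intros [c u]; split; [now rewrite <- !emb_comp, c|].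
  intros t A B e.
  destruct (common_domain A B) as (s & v & a & b & Hv & ea & eb).
  destruct (@emb_eq s z (f ∘ a) (g ∘ b)) as (r & v' & Hv' & e').
  { now rewrite !emb_comp, <- ea, <- eb, !comp_assoc, e. }
  destruct (u r (a ∘ v') (b ∘ v')) as [h [[h1 h2] _]].
  { now rewrite !comp_assoc. }
  assert (Hvv : W (v ∘ v')) by now apply (dc_comp DW).
  destruct (emb_iso Hvv) as [i [i1 i2]].
  exists (emb h ∘ i); split.
  - split.
    + rewrite comp_assoc, <- emb_comp, h1, emb_comp, <- ea, <- (comp_assoc A),
        <- emb_comp, <- comp_assoc, i2; apply comp_id_r.
    + rewrite comp_assoc, <- emb_comp, h2, emb_comp, <- eb, <- (comp_assoc B),
        <- emb_comp, <- comp_assoc, i2; apply comp_id_r.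
  - intros K [K1 K2].
    apply (emb_epi Hvv); rewrite <- comp_assoc, i1, comp_id_r.
    destruct (domain_of (K ∘ emb (v ∘ v') : @hom L r w)) as (r1 & v1 & k & Hv1 & ek).
    destruct (@emb_eq r1 x (p ∘ k) (a ∘ v' ∘ v1)) as (r2 & v2 & Hv2 & e2).
    { now rewrite !emb_comp, <- ek, <- ea, !emb_comp, !comp_assoc, K1. }
    destruct (@emb_eq r1 y (q ∘ k) (b ∘ v' ∘ v1)) as (r3 & v3 & Hv3 & e3).
    { now rewrite !emb_comp, <- ek, <- eb, !emb_comp, !comp_assoc, K2. }
    (* [r4] is the intersection of the domains on which the two legs of [k] agree with those of
       [h]. *)
    destruct (PB v2 v3) as (r4 & w2 & w3 & H4).
    assert (Hw3 : W w3) by exact (dc_pullback DW H4 Hv2).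
    apply (emb_epi Hv1); rewrite ek.
    apply (emb_epi (dc_comp DW Hv3 Hw3)); rewrite <- !emb_comp; f_equal.
    apply (pullback_ext (conj c u)).
    + now rewrite <- (proj1 H4), !comp_assoc, e2, h1.
    + now rewrite !comp_assoc, e3, h2.
Qed.

Lemma loc_pullback {x y z : C} (f : @hom L x z) (g : @hom L y z) :
  exists (w x' y' : C) (i : hom x' x) (j : hom y' y) (f' : hom x' z) (g' : hom y' z)
      (p : hom w x') (q : hom w y'),
    W i /\ W j /\ f ∘ emb i = emb f' /\ g ∘ emb j = emb g' /\
    IsPullback p q f' g' /\ IsPullback (emb (i ∘ p)) (emb (j ∘ q)) f g.
Proof.
  destruct (domain_of f) as (x' & i & f' & Hi & ef).
  destruct (domain_of g) as (y' & j & g' & Hj & eg).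
  destruct (PB f' g') as (w & p & q & H).
  exists w, x', y', i, j, f', g', p, q; repeat (split; [assumption|]).
  rewrite !emb_comp.
  exact (pullback_transport (C := L) (id_iso (w : L)) (emb_iso Hi) (emb_iso Hj)
    (comp_id_r _) (comp_id_r _) ef eg (emb_pullback H)).
Qed.

Lemma loc_enough_pullbacks : EnoughPullbacks L.
Proof.
  intros x y z f g.
  destruct (loc_pullback f g) as (w & x' & y' & i & j & f' & g' & p & q & H).
  exists w, (emb (i ∘ p)), (emb (j ∘ q)); apply H.
Qed.

(** * Finite sums in the localization *)

Section Sums.
Context (S : FiniteSums C) (St : StableSums S) (Dj : DisjointSums S).
Context (Wsum : forall (a b a' b' : C) (v : hom a a') (w : hom b b'),
  W v -> W w -> W (sum_map S v w)).

Lemma emb_initial : @IsInitial L (zero S).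
Proof.
  intros x; exists (emb (from_zero S x)); split; [trivial|]; intros R _.
  destruct (domain_of R) as (t & w & g & Hw & e).
  apply (emb_epi Hw); rewrite e, <- emb_comp; f_equal.
  apply (void_ext St); constructor; exact w.
Qed.

(** By [Wsum] the sum of the domains of two representatives is a domain in [a + b], on which their
    copairing represents the mediating map. *)
Lemma emb_coproduct (a b : C) : IsCoproduct (emb (inl S a b)) (emb (inr S a b)).
Proof.
  intros t P R.
  destruct (domain_of P) as (a' & v & f & Hv & ef).
  destruct (domain_of R) as (b' & w & g & Hw & eg).
  destruct (emb_iso (Wsum Hv Hw)) as [i [i1 i2]].
  assert (el : emb (copair S f g) ∘ i ∘ emb (inl S a b) = P).
  { apply (emb_epi Hv); rewrite ef, <- !comp_assoc, <- emb_comp, <- (sum_map_inl S v w),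
      emb_comp, (comp_assoc i), i1, comp_id_l, <- emb_comp; f_equal; apply copair_inl. }
  assert (er : emb (copair S f g) ∘ i ∘ emb (inr S a b) = R).
  { apply (emb_epi Hw); rewrite eg, <- !comp_assoc, <- emb_comp, <- (sum_map_inr S v w),
      emb_comp, (comp_assoc i), i1, comp_id_l, <- emb_comp; f_equal; apply copair_inr. }
  exists (emb (copair S f g) ∘ i); split; [now split|].
  assert (ext : forall H K : @hom L (sum S a b) t,
      H ∘ emb (inl S a b) = K ∘ emb (inl S a b) ->
      H ∘ emb (inr S a b) = K ∘ emb (inr S a b) -> H = K).
    { intros H K e1 e2.
      destruct (common_domain H K) as (s & u & h & k & Hu & eh & ek).
      (* The common domain [u] is pulled back along each coprojection and shrunk until [h] and [k]
         agree; the two pieces add up to a domain in the sum. *)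
      assert (part : forall (c : C) (j : hom c (sum S a b)), H ∘ emb j = K ∘ emb j ->
        exists (c' : C) (r : hom c' c) (l : hom c' s),
          W r /\ u ∘ l = j ∘ r /\ h ∘ l = k ∘ l).
      { intros c j e; destruct (PB u j) as (c' & l & r & Hlr).
        destruct (@emb_eq c' t (h ∘ l) (k ∘ l)) as (c'' & v' & Hv' & e').
        { now rewrite !emb_comp, <- eh, <- ek, <- !comp_assoc, <- emb_comp, (proj1 Hlr),
            emb_comp, !comp_assoc, e. }
        exists c'', (r ∘ v'), (l ∘ v'); split; [|split].
        - exact (dc_comp DW (dc_pullback DW Hlr Hu) Hv').
        - now rewrite !comp_assoc, (proj1 Hlr).
        - now rewrite !comp_assoc. }
      destruct (part _ _ e1) as (a1 & r1 & l1 & Hr1 & c1 & d1).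
      destruct (part _ _ e2) as (b1 & r2 & l2 & Hr2 & c2 & d2).
      apply (emb_epi (Wsum Hr1 Hr2)).
      assert (em : sum_map S r1 r2 = u ∘ copair S l1 l2).
      { unfold sum_map; rewrite copair_comp; congruence. }
      rewrite em, emb_comp, !comp_assoc, eh, ek, <- !emb_comp, !copair_comp; congruence. }
  intros K [K1 K2]; apply ext; congruence.
Qed.

Definition loc_sums : FiniteSums L := {|
  zero := zero S : L;
  zero_initial := emb_initial;
  sum := fun a b : L => sum S a b : L;
  inl := fun a b : L => emb (inl S a b);
  inr := fun a b : L => emb (inr S a b);
  sum_coproduct := emb_coproduct |}.

Lemma emb_copair {a b t : C} (f : hom a t) (g : hom b t) :
  emb (copair S f g) = copair loc_sums (emb f) (emb g).
Proof.
  apply (sum_ext (S := loc_sums)).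
  - rewrite copair_inl; change (emb (copair S f g) ∘ emb (inl S a b) = emb f).
    now rewrite <- emb_comp, copair_inl.
  - rewrite copair_inr; change (emb (copair S f g) ∘ emb (inr S a b) = emb g).
    now rewrite <- emb_comp, copair_inr.
Qed.

Lemma emb_sum_map {a b a' b' : C} (f : hom a a') (g : hom b b') :
  emb (sum_map S f g) = sum_map loc_sums (emb f) (emb g).
Proof. unfold sum_map; now rewrite emb_copair, !emb_comp. Qed.

Lemma loc_disjoint : DisjointSums loc_sums.
Proof.
  intros a b; destruct (Dj a b) as [ml [mr H]]; split; [|split].
  - exact (pullback_mono (emb_pullback (mono_pullback ml))).
  - exact (pullback_mono (emb_pullback (mono_pullback mr))).
  - apply emb_pullback in H.
    assert (e : forall x : L, from_zero loc_sums x = emb (from_zero S x)).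
    { intros x; apply (exists_unique_eq (emb_initial x)); trivial. }
    rewrite !e; exact H.
Qed.

Lemma loc_stable_sums : StableSums loc_sums.
Proof.
  intros y z x1 x2 w1 w2 f d1 d2 p1 q1 p2 q2 H1 H2.
  destruct (domain_of f) as (y' & j & f' & Hj & ef).
  destruct (domain_of d1) as (x1' & i1 & d1' & Hi1 & ed1).
  destruct (domain_of d2) as (x2' & i2 & d2' & Hi2 & ed2).
  destruct (PB d1' f') as (u1 & a1 & b1 & G1).
  destruct (PB d2' f') as (u2 & a2 & b2 & G2).
  (* Identifies a given pullback with the image of the pullback of representatives, so that
     stability in [C] can be applied to the latter. *)
  assert (K : forall (x x' w u : C) (i : hom x' x) (d : @hom L x z) (d' : hom x' z)
      (p : @hom L w x) (q : @hom L w y) (a : hom u x') (b : hom u y'),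
    W i -> d ∘ emb i = emb d' -> IsPullback p q d f -> IsPullback a b d' f' ->
    exists k : @hom L u w, IsIso k /\ p ∘ k = emb i ∘ emb a /\ q ∘ k = emb j ∘ emb b).
  { intros x x' w u i d d' p q a b Hi ed H G.
    apply (pullback_unique H).
    exact (pullback_transport (C := L) (id_iso (u : L)) (emb_iso Hi) (emb_iso Hj)
      (comp_id_r _) (comp_id_r _) ed ef (emb_pullback G)). }
  destruct (K _ _ _ _ _ _ _ _ _ _ _ Hi1 ed1 H1 G1) as (k1 & Hk1 & ek1 & el1).
  destruct (K _ _ _ _ _ _ _ _ _ _ _ Hi2 ed2 H2 G2) as (k2 & Hk2 & ek2 & el2).
  pose proof (emb_pullback (St G1 G2)) as G.
  rewrite emb_sum_map, !emb_copair in G.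
  refine (pullback_transport (C := L) (sum_map_iso loc_sums Hk1 Hk2)
    (sum_map_iso loc_sums (emb_iso Hi1) (emb_iso Hi2)) (emb_iso Hj) _ _ _ ef G).
  - now rewrite <- !sum_map_comp, ek1, ek2.
  - now rewrite sum_map_copair, copair_comp, el1, el2.
  - now rewrite sum_map_copair, ed1, ed2.
Qed.

End Sums.
End PartialMaps.

(** * Derivatives in the localization at dense monomorphisms *)

Section DenseLocalization.
Context (E : Category) (lccE : LocallyCartesianClosed E) (S : FiniteSums E)
  (Dj : DisjointSums S).

Notation W := (DenseMono lccE S).
Notation L := (Localization W).
Notation Q := (loc W).
Let St := lcc_stable_sums lccE S.
Let PB := lcc_enough_pullbacks lccE.
Let DW : DomainClass W := dense_mono_class (lccE) S.

Definition dense_loc_sums : FiniteSums L :=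
  loc_sums DW PB St (@dense_mono_sum_map E lccE S Dj).

Lemma dense_loc_stable : StableSums dense_loc_sums.
Proof. apply loc_stable_sums. Qed.

Lemma dense_loc_disjoint : DisjointSums dense_loc_sums.
Proof. now apply loc_disjoint. Qed.

Lemma dense_loc_enough : EnoughPullbacks L.
Proof. exact (loc_enough_pullbacks DW PB). Qed.

Lemma dense_loc_pullback : PreservesPullbacks Q.
Proof. intros w x y z p q f g H; exact (emb_pullback DW PB H). Qed.

Lemma dense_loc_preserves_sums : PreservesFiniteSums S Q.
Proof.
  split; [exact (zero_initial dense_loc_sums)|].
  intros a b; exact (sum_coproduct dense_loc_sums a b).
Qed.

Lemma dense_loc_preserves_derivatives :
  PreservesDistributivityPullbacks Q ->
  PreservesDerivatives Q dense_loc_pullback S St dense_loc_sums dense_loc_stable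
    dense_loc_preserves_sums.
Proof.
  intros Hdist p d u Du.
  destruct (lcc_pb lccE (ar_arr p) (ar_arr p)) as [P p1 p2 HP].
  destruct (kernel_diagonal HP) as [dg [d1 d2]].
  pose proof (dense_mono_neg_sum lccE S (retract_mono d1)) as Hm.
  destruct (derivative_distributivity Dj PB HP d1 d2 (neg_mono St (q := dg))
    (apart_neg (q := dg)) (fun t x => @neg_factor E lccE S St _ _ t dg x) Du) as [i Hi].
  pose proof (iso_of_distributivity (loc_inverts Hm) (Hdist _ _ _ _ _ _ _ _ _ _ Hi)) as Hp.
  apply (derivative_of_iso_point dense_loc_disjoint dense_loc_enough).
  (* The sum comparison respects [inr], so the image square has the image of [point u] as its
     point. *)
  refine (eq_ind (emb W (point u)) (@IsIso L _ _) Hp _ _).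
  change (emb W (sq_dom u ∘ inr S (ar_dom d) (ar_cod d)) =
    emb W (sq_dom u) ∘ sum_comparison Q S dense_loc_sums (ar_dom d) (ar_cod d)
      ∘ inr dense_loc_sums (ar_dom d) (ar_cod d)).
  rewrite <- comp_assoc; unfold sum_comparison; rewrite copair_inr.
  apply emb_comp.
Qed.

(** The derivative is built in [E] from a representative [f'] of [f] on a dense [A]: it is the
    projection to [A] of the negated diagonal of [f'], with point the invertible [emb W w]. *)
Lemma dense_loc_derivative (p : Poly11 L) :
  exists (d : Poly11 L) (u : hom (star1 dense_loc_sums dense_loc_stable d) p),
    IsDerivative dense_loc_stable p d u.
Proof.
  destruct p as [X Y f].
  destruct (domain_of DW PB f) as (A & w & f' & Hw & ef).
  destruct (lcc_pb lccE f' f') as [P p1 p2 HP].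
  destruct (kernel_diagonal HP) as [dg [d1 d2]].
  pose proof (emb_iso (dense_mono_neg_sum lccE S (retract_mono d1))) as Hm.
  set (n := sl_arr (neg lccE S dg)) in *.
  set (m := copair S n dg) in *.
  (* The kernel pair square of [f'], with its apex replaced along [m] by a sum and one copy of [A]
     replaced by [X] along [w]. *)
  assert (Hu : IsPullback (emb W w ∘ (emb W p1 ∘ emb W m))
    (copair dense_loc_sums (emb W (p2 ∘ n)) (idm (A : L))) f (emb W f')).
  { replace (copair dense_loc_sums _ _) with (emb W p2 ∘ emb W m).
    - refine (pullback_transport (C := L) (id_iso _) (emb_iso Hw) (id_iso _) _ _ ef
        (comp_id_r _) (pullback_iso Hm (emb_pullback DW PB HP))).
      + apply comp_id_r.
      + now rewrite comp_id_r, comp_id_l.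
    - rewrite <- emb_comp; unfold m; rewrite copair_comp, d2.
      apply emb_copair. }
  pose (d := mkArr (emb W (p2 ∘ n)) : Poly11 L).
  exists d, (@mkSquare L (star1_ob dense_loc_sums d) (mkArr f) _ _ Hu).
  apply (derivative_of_iso_point dense_loc_disjoint dense_loc_enough).
  refine (eq_ind (emb W w) (@IsIso L _ _) (emb_iso Hw) _ _).
  change (emb W w = emb W w ∘ (emb W p1 ∘ emb W m) ∘ emb W (inr S _ A)).
  rewrite <- !comp_assoc, <- !emb_comp; unfold m.
  now rewrite copair_inr, d1, comp_id_r.
Qed.

End DenseLocalization.

Theorem theorem5p1p6 (E : Category) (lccE : LocallyCartesianClosed E)
    (oneE : Terminal E) (sumE : FiniteSums E) (disjE : DisjointSums sumE) :
  let W := DenseMono lccE sumE in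
  let L := Localization W in
  let Q := loc W in
  IsTerminal (Q (one oneE)) /\
  exists (sumL : FiniteSums L) (stL : StableSums sumL)
         (Qpb : PreservesPullbacks Q) (Qsum : PreservesFiniteSums sumE Q),
    (PreservesDistributivityPullbacks Q ->
     PreservesDerivatives Q Qpb sumE (lcc_stable_sums lccE sumE) sumL stL Qsum) /\
    (forall p : Poly11 L,
       exists (d : Poly11 L) (u : hom (star1 sumL stL d) p), IsDerivative stL p d u).
Proof.
  intros W L Q; split.
  - exact (emb_terminal (dense_mono_class lccE sumE) (lcc_enough_pullbacks lccE)
      (one_terminal oneE)).
  - exists (dense_loc_sums lccE disjE), (@dense_loc_stable E lccE sumE disjE),
      (@dense_loc_pullback E lccE sumE), (@dense_loc_preserves_sums E lccE sumE disjE).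
    split; [apply dense_loc_preserves_derivatives | apply dense_loc_derivative].
Qed.
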